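(* Let $a$ and $b$ be positive integers. Then there exists a 4-GDD of type $(3a)^4(6a)^1(3b)^1$ if and only if $a\le b\le 2a$.
   Context: A 4-GDD of type $g_1^{u_1}g_2^{u_2}\cdots g_r^{u_r}$ is a triple $(V,\mathcal G,\mathcal B)$ where $V$ is a set of $u_1g_1+\cdots+u_rg_r$ points, $\mathcal G$ is a partition of $V$ into $u_i$ groups of size $g_i$ for each $i$, and $\mathcal B$ is a non-empty collection of 4-element subsets of $V$ (blocks) such that every pair of points from distinct groups lies in exactly one block and no pair of points from the same group lies in any block. *)

(* Defs.v *)
From mathcomp Require Import all_boot.
Set Implicit Arguments. Unset Strict Implicit. Unset Printing Implicit Defensive.

Definition is_4GDD (T : finType) (G : {set {set T}}) (B : {set {set T}}) : Prop :=
  [/\ partition G [set: T] /\ set0 \notin G,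
      B != set0,
      (forall b, b \in B -> #|b| = 4),
      (forall b x y, b \in B -> x \in b -> y \in b -> x != y ->
          pblock G x != pblock G y) &
      (forall x y, pblock G x != pblock G y ->
          #|[set b in B | (x \in b) && (y \in b)]| = 1)].

(* The type g_1^{u_1} ... g_r^{u_r}, given as a list of pairs (g_i, u_i),
   expanded into the multiset of group sizes. *)
Definition gdd_type_sizes (ty : seq (nat * nat)) : seq nat :=
  flatten [seq nseq p.2 p.1 | p <- ty].

Definition gdd_type_points (ty : seq (nat * nat)) : nat :=
  sumn [seq p.1 * p.2 | p <- ty].

Definition exists_4GDD (ty : seq (nat * nat)) : Prop :=
  exists (G B : {set {set 'I_(gdd_type_points ty)}}),
    is_4GDD G B /\
    perm_eq [seq #|A : {set _}| | A <- enum G] (gdd_type_sizes ty).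

(* Main.v *)
(* Necessity. A point x of a group H lies on (v - |H|) / 3 blocks, and the points of another
   group M lie on distinct blocks through x, so 3 |M| + |H| <= v. Taking group sizes
   (|H|, |M|) = (3a, 6a) and (6a, 3b) gives a <= b and b <= 2a.

   Sufficiency. Give the points of a transversal design TD(6, n) the weights 3c (four groups),
   6c (fifth group) and 3e, with e in [c, 2c] depending on the point (sixth group), in Wilson's
   fundamental construction: if every b in [c, 2c] is feasible for c, then every b in [cn, 2cn]
   is feasible for cn. There is a TD(6, q) for each prime power q >= 5, and a TD(6, 12), so only
   a = 1, 2, 3, 4, 6 remain. There the designs are inflations by TD(4, 3) and TD(4, 4) of smaller
   ones, or come from explicit cyclic difference families that were found by computer search. *)
Require Import Defs.
From mathcomp Require Import all_boot all_algebra all_field zify ring.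
Set Implicit Arguments. Unset Strict Implicit. Unset Printing Implicit Defensive.

(** * Point degrees and necessity *)

(** The threshold 5 comes from affine planes: a field of order [q] yields [q + 1] columns of an
    orthogonal array, and six are needed. The prime powers below 5 are 2, 3 and 4, so the part of
    [a] out of reach of fields divides 12. Since there is no TD(6, 3) and no TD(6, 4), 12 needs an
    array of its own. Inflation by [n] multiplies [a] and [b] alike, hence reaches only values of
    [b] divisible by [n], and there is no TD(4, 2) with which to double a design; this is why so
    many values of [b] had to be searched. For Wilson's construction to compose, designs are handled
    through a label function and the group sizes alone, with empty groups allowed. Set partitions
    occur only at the two ends, in the necessity and in the last step of the sufficiency. *)

Section Necessity.

Variables (T : finType) (G B : {set {set T}}).
Hypothesis gddGB : is_4GDD G B.

(** Double counting of the pairs [(y, b)] with [y] outside the group of [x] and both [x] and [y] in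
    [b]: each such [y] occurs once, each block through [x] occurs 3 times. *)
Lemma gdd_degree (x : T) :
  3 * #|[set b in B | x \in b]| + #|pblock G x| = #|T|.
Proof.
have [[partG _] _ B4 Bgroup Bpair] := gddGB.
have covG y : y \in cover G by rewrite (cover_partition partG) inE.
have [_ trivG _] := and3P partG.
rewrite -[RHS](cardC (mem (pblock G x))) addnC; congr (_ + _).
have -> : #|[predC pblock G x]| = \sum_(y | pblock G x != pblock G y) 1.
  rewrite sum1_card; apply: eq_card => y.
  by rewrite -[LHS]/(y \notin pblock G x) -eq_pblock.
rewrite (eq_bigr (fun y => \sum_(b in B | (x \in b) && (y \in b)) 1)); last first.
  by move=> y /Bpair {1}<-; rewrite sum1_card; apply: eq_card => b; rewrite !inE.
rewrite (exchange_big_dep (fun b => (b \in B) && (x \in b))) /=; last first.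
  by move=> y b _ /and3P[-> ->].
rewrite (eq_bigr (fun _ => 3)); last first.
  move=> b /andP[Bb xb].
  have -> : 3 = #|b :\ x| by have := cardsD1 x b; rewrite xb B4 //; case.
  rewrite sum1_card; apply: eq_card => y; rewrite in_setD1.
  rewrite -[LHS]/[&& pblock G x != pblock G y, b \in B, x \in b & y \in b] Bb xb /=.
  case yb: (y \in b); rewrite ?andbF ?andbT //.
  apply/idP/idP => [|ne]; first by apply: contraNneq => ->.
  by apply: Bgroup Bb _ _ _ => //; rewrite eq_sym.
by rewrite sum_nat_const mulnC; congr (_ * _); apply: eq_card => b; rewrite !inE.
Qed.

(** Each point of [M] shares exactly one block with [x], and no block holds two points of one group,
    so the same exchange of sums gives the bound. *)
Lemma gdd_group_le_degree (x : T) (M : {set T}) :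
  M \in G -> x \notin M -> #|M| <= #|[set b in B | x \in b]|.
Proof.
have [[partG _] _ B4 Bgroup Bpair] := gddGB.
have [_ trivG _] := and3P partG.
move=> GM xM.
have pM y : y \in M -> pblock G y = M by apply: def_pblock.
have ne y : y \in M -> pblock G x != pblock G y.
  move=> yM; rewrite (pM _ yM); apply: contraNneq xM => <-.
  by rewrite mem_pblock (cover_partition partG) inE.
rewrite -sum1_card (eq_bigr (fun y => \sum_(b in B | (x \in b) && (y \in b)) 1)); last first.
  by move=> y yM; rewrite -{1}(Bpair _ _ (ne _ yM)) sum1_card; apply: eq_card => b; rewrite !inE.
rewrite (exchange_big_dep (fun b => (b \in B) && (x \in b))) /=; last first.
  by move=> y b _ /and3P[-> ->].
rewrite -[X in _ <= X]sum1_card [X in _ <= X](eq_bigl (fun b => (b \in B) && (x \in b))); last first.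
  by move=> b; rewrite !inE.
apply: leq_sum => b /andP[Bb xb]; rewrite sum1_card; apply/card_le1_eqP => y z.
move=> /andP[yM /and3P[_ _ yb]] /andP[zM /and3P[_ _ zb]].
apply/eqP; apply: contraT => yz.
by have := Bgroup _ _ _ Bb zb yb yz; rewrite (pM _ yM) (pM _ zM) eqxx.
Qed.

Lemma gdd_groups_bound (H M : {set T}) :
  H \in G -> M \in G -> H != M -> 3 * #|M| + #|H| <= #|T|.
Proof.
move=> GH GM neHM; have [[partG G0] _ _ _ _] := gddGB.
have [_ trivG _] := and3P partG.
have /set0Pn[x Hx] : H != set0 by apply: contraNneq G0 => <-.
rewrite -(gdd_degree x) (def_pblock trivG GH Hx) leq_add2r leq_mul2l /=.
apply: gdd_group_le_degree => //; apply: contraNN neHM => Mx.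
by rewrite -(def_pblock trivG GH Hx) (def_pblock trivG GM Mx).
Qed.

End Necessity.

Lemma exists_4GDD_bounds (a b : nat) : 0 < a -> 0 < b ->
  exists_4GDD [:: (3 * a, 4); (6 * a, 1); (3 * b, 1)] -> a <= b <= 2 * a.
Proof.
move=> a0 b0 [G [B [gddGB sizes]]].
have group_of_size n : n \in gdd_type_sizes [:: (3 * a, 4); (6 * a, 1); (3 * b, 1)] ->
    exists2 H, H \in G & #|H| = n.
  by rewrite -(perm_mem sizes) => /mapP[H]; rewrite mem_enum => GH ->; exists H.
have [H GH H3] := group_of_size (3 * a) ltac:(by rewrite !inE eqxx).
have [M GM M6] := group_of_size (6 * a) ltac:(by rewrite !inE eqxx ?orbT).
have [N GN N3] := group_of_size (3 * b) ltac:(by rewrite !inE eqxx ?orbT).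
have card_pts : #|'I_(gdd_type_points [:: (3 * a, 4); (6 * a, 1); (3 * b, 1)])| = 18 * a + 3 * b.
  by rewrite card_ord /gdd_type_points /=; lia.
have neHM : H != M by apply: contraTneq isT => e; move: H3; rewrite e M6; lia.
have := gdd_groups_bound gddGB GH GM neHM; rewrite card_pts H3 M6 => bound1.
(* The groups are found by size only, so [N] may be [M] itself; this forces [b = 2 * a], and the
   claim is immediate. *)
have [eNM|neNM] := eqVneq N M; first by move: N3; rewrite eNM M6; lia.
rewrite eq_sym in neNM.
have := gdd_groups_bound gddGB GM GN neNM; rewrite card_pts N3 M6 => bound2.
by lia.
Qed.

(** * Group divisible designs and Wilson's fundamental construction *)

(** The groups are the fibres of [k] on [A], possibly empty, and block sizes are free, so that
    transversal designs, master designs and ingredients all fall under one notion. *)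
Definition is_gdd (V I : finType) (k : V -> I) (A : {set V}) (C : {set {set V}}) :=
  [/\ {in C, forall c : {set V}, c \subset A},
      {in C, forall c : {set V}, {in c &, injective k}},
      {in A &, forall x y, k x != k y -> exists2 c, c \in C & (x \in c) && (y \in c)} &
      {in C &, forall (c c' : {set V}) x y, x != y -> x \in c -> y \in c ->
         x \in c' -> y \in c' -> c = c'}].

Definition has_4gdd (I : finType) (s : I -> nat) :=
  exists (V : finType) (k : V -> I) (A : {set V}) (C : {set {set V}}),
    [/\ is_gdd k A C, {in C, forall c : {set V}, #|c| = 4} &
        forall i, #|[set x in A | k x == i]| = s i].

(** Points of equal rank in the fibres of equal label are matched. The [option] supplies a value
    outside [A], where [V'] may have nothing to offer. *)
Lemma fibre_bijection (V V' I : finType) (k : V -> I) (k' : V' -> I)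
    (A : {set V}) (A' : {set V'}) :
  (forall i, #|[set x in A | k x == i]| = #|[set x in A' | k' x == i]|) ->
  exists f : V -> option V',
    [/\ {in A &, injective f},
        {in A, forall x, exists2 x', f x = Some x' & (x' \in A') && (k' x' == k x)} &
        {in A', forall x', exists2 x, x \in A & f x = Some x'}].
Proof.
move=> hcard.
pose F i := enum [set x in A | k x == i]; pose F' i := enum [set x in A' | k' x == i].
have hsz i : size (F i) = size (F' i) by rewrite /F /F' -!cardE.
have memF x : x \in A -> x \in F (k x) by move=> Ax; rewrite mem_enum inE Ax eqxx.
pose f x := nth None [seq Some x' | x' <- F' (k x)] (index x (F (k x))).
have fE x : x \in A ->
    exists2 x', f x = Some x' & [/\ x' \in F' (k x) & index x' (F' (k x)) = index x (F (k x))].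
  move=> Ax; have := memF _ Ax; rewrite -index_mem hsz => hi.
  case E: (F' (k x)) hi => [|y0 s'] // hi; rewrite -E in hi *.
  exists (nth y0 (F' (k x)) (index x (F (k x)))); first by rewrite /f (nth_map y0).
  by split; [apply: mem_nth | rewrite index_uniq ?enum_uniq].
have F'P i x' : x' \in F' i -> (x' \in A') /\ k' x' = i.
  by rewrite mem_enum inE => /andP[-> /eqP].
exists f; split.
- move=> x y Ax Ay; have [x' -> [hx ix]] := fE _ Ax; have [y' -> [hy iy]] := fE _ Ay.
  case=> exy; subst y'.
  have [_ ex] := F'P _ _ hx; have [_ ey] := F'P _ _ hy.
  have kxy : k x = k y by rewrite -ex -ey.
  have : index x (F (k x)) = index y (F (k x)) by rewrite -ix kxy iy.
  by apply: index_inj; rewrite ?memF // kxy memF.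
- move=> x Ax; have [x' e [hx _]] := fE _ Ax; exists x' => //.
  by have [-> ->] := F'P _ _ hx; rewrite eqxx.
- move=> x' Ax'.
  have hx' : x' \in F' (k' x') by rewrite mem_enum inE Ax' eqxx.
  have hi : index x' (F' (k' x')) < size (F (k' x')) by rewrite hsz index_mem.
  case E: (F (k' x')) hi => [|y0 s'] // hi; rewrite -E in hi *.
  set x := nth y0 (F (k' x')) (index x' (F' (k' x'))).
  have : x \in F (k' x') by apply: mem_nth.
  rewrite mem_enum inE => /andP[Ax /eqP kx].
  exists x => //; rewrite /f kx index_uniq ?enum_uniq //.
  by rewrite (nth_map x') ?index_mem // nth_index.
Qed.

Lemma is_gdd_transport (V V' I : finType) (k : V -> I) (k' : V' -> I)
    (A : {set V}) (A' : {set V'}) (C : {set {set V}}) :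
  (forall i, #|[set x in A | k x == i]| = #|[set x in A' | k' x == i]|) ->
  is_gdd k A C -> {in C, forall c : {set V}, #|c| = 4} ->
  exists2 C' : {set {set V'}}, is_gdd k' A' C' & {in C', forall c : {set V'}, #|c| = 4}.
Proof.
move=> /fibre_bijection[f [f_inj fA fsurj]] [CA Ck Ccov Cuniq] C4.
pose im (c : {set V}) : {set V'} := [set x' | Some x' \in f @: c].
have imP (c : {set V}) x' : x' \in im c -> exists2 x, x \in c & f x = Some x'.
  by rewrite inE => /imsetP[x cx ->]; exists x.
have im_in (c : {set V}) x x' : x \in c -> f x = Some x' -> x' \in im c.
  by move=> cx e; rewrite inE -e imset_f.
exists [set im c | c in C].
  split.
  - move=> _ /imsetP[c Cc ->]; apply/subsetP=> x' /imP[x cx fx].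
    have [y fy /andP[Ay _]] := fA _ (subsetP (CA _ Cc) _ cx).
    by move: fy; rewrite fx => -[->].
  - move=> _ /imsetP[c Cc ->] x' y' /imP[x cx fx] /imP[y cy fy] e.
    have [z fz /andP[_ /eqP kz]] := fA _ (subsetP (CA _ Cc) _ cx).
    have [t ft /andP[_ /eqP kt]] := fA _ (subsetP (CA _ Cc) _ cy).
    move: fz ft; rewrite fx fy => -[ez] [et]; subst z t.
    have exy : x = y by apply: (Ck _ Cc) => //; rewrite -kz -kt.
    by move: fx; rewrite exy fy => -[].
  - move=> x' y' Ax' Ay' ne.
    have [x Ax fx] := fsurj _ Ax'; have [y Ay fy] := fsurj _ Ay'.
    have [z fz /andP[_ /eqP kz]] := fA _ Ax; have [t ft /andP[_ /eqP kt]] := fA _ Ay.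
    move: fz ft; rewrite fx fy => -[ez] [et]; subst z t.
    have [|c Cc /andP[cx cy]] := Ccov _ _ Ax Ay; first by rewrite -kz -kt.
    exists (im c); first exact: imset_f.
    by rewrite (im_in _ _ _ cx fx) (im_in _ _ _ cy fy).
  - move=> _ _ /imsetP[c Cc ->] /imsetP[d Cd ->] x' y' ne.
    move=> /imP[x cx fx] /imP[y cy fy] /imP[x1 dx fx1] /imP[y1 dy fy1].
    have ex : x = x1 by apply: f_inj; rewrite ?fx ?fx1 //; [apply: (subsetP (CA _ Cc)) | apply: (subsetP (CA _ Cd))].
    have ey : y = y1 by apply: f_inj; rewrite ?fy ?fy1 //; [apply: (subsetP (CA _ Cc)) | apply: (subsetP (CA _ Cd))].
    subst x1 y1; congr im; apply: (Cuniq _ _ Cc Cd x y) => //.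
    by apply: contraNneq ne => exy; move: fx; rewrite exy fy => -[->].
move=> _ /imsetP[c Cc ->]; rewrite -(C4 _ Cc).
have c_inj : {in c &, injective f}.
  by move=> x y cx cy; apply: f_inj; apply: (subsetP (CA _ Cc)).
rewrite -(card_in_imset c_inj) -(card_imset (mem (im c)) (Some_inj : injective (@Some V'))).
apply: eq_card => o; apply/imsetP/imsetP.
  by move=> [x' hx ->]; have [x cx fx] := imP _ _ hx; exists x.
move=> [x cx ->]; have [x' fx _] := fA _ (subsetP (CA _ Cc) _ cx).
by exists x' => //; apply: im_in fx.
Qed.

(** Frees a design from its point set: an ingredient can then be placed exactly on the copies of the
    points of a given block. *)
Lemma has_4gdd_on (V I : finType) (k : V -> I) (A : {set V}) (s : I -> nat) :
  has_4gdd s -> (forall i, #|[set x in A | k x == i]| = s i) ->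
  exists2 C : {set {set V}}, is_gdd k A C & {in C, forall c : {set V}, #|c| = 4}.
Proof.
move=> [W [l [D [C [hC C4 hs]]]]] hA.
by apply: is_gdd_transport hC C4 => i; rewrite hs hA.
Qed.

Lemma card_under_graph (T : finType) N (P : pred T) (w : T -> nat) :
  (forall x, w x <= N) ->
  #|[set v : T * 'I_N | P v.1 && (v.2 < w v.1)]| = \sum_(x | P x) w x.
Proof.
move=> le_wN.
rewrite -sum1_card (eq_bigl (fun v : T * 'I_N => P v.1 && (v.2 < w v.1))); last first.
  by move=> v; rewrite inE.
rewrite -(pair_big_dep P (fun x (j : 'I_N) => j < w x) (fun _ _ => 1)) /=.
apply: eq_bigr => x _; rewrite sum1_card -[RHS]card_ord.
have widen_inj : injective (widen_ord (le_wN x)) by move=> j j' /(congr1 val) /= /val_inj.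
rewrite -(card_imset _ widen_inj); apply: eq_card => j.
apply/idP/imsetP => [jw | [i _ ->]]; last exact: (ltn_ord i).
by exists (Ordinal (jw : j < w x)) => //; apply: val_inj.
Qed.

(* Wilson's fundamental construction *)
Lemma has_4gdd_weight (T I : finType) (g : T -> I) (A : {set T}) (B : {set {set T}})
    (w : T -> nat) (s : I -> nat) :
  is_gdd g A B ->
  {in B, forall b : {set T}, has_4gdd (fun x => (x \in b) * w x)} ->
  (forall i, \sum_(x in A | g x == i) w x = s i) ->
  has_4gdd s.
Proof.
move=> [BA Bg Bcov Buniq] ingr hs.
(* A point [x] is replaced by the copies [(x, j)] with [j < w x]; the largest weight bounds [j]. *)
pose N := \max_x w x.
pose V := (T * 'I_N)%type : finType.
pose fib (P : pred T) : {set V} := [set v : V | P v.1 && (v.2 < w v.1)].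
have card_fib P : #|fib P| = \sum_(x | P x) w x.
  by apply: card_under_graph => x; apply: leq_bigmax.
pose good (b : {set T}) (C : {set {set V}}) :=
  is_gdd (@fst T 'I_N) (fib (mem b)) C /\ {in C, forall c : {set V}, #|c| = 4}.
have goodP b : b \in B -> exists C, good b C.
  move=> Bb; have [|C hC C4] := @has_4gdd_on V T fst (fib (mem b)) _ (ingr b Bb); last by exists C.
  move=> x.
  case xb: (x \in b); last first.
    rewrite mul0n; apply: eq_card0 => v; rewrite !inE /=.
    by apply: contraFF xb => /andP[/andP[vb _] /eqP <-].
  rewrite mul1n -(big_pred1_eq addn x w) -card_fib; apply: eq_card => v; rewrite !inE /=.
  by case: eqP => [->|_]; rewrite ?xb ?andbT ?andbF.
(* One ingredient is chosen for every block of the master design; its groups are the sets of copies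
   of single points. *)
have [C Cgood] : exists C : {set T} -> {set {set V}}, forall b, b \in B -> good b (C b).
  apply: (fin_all_exists (P := fun b X => b \in B -> good b X)) => b.
  by case Bb: (b \in B); [have [X] := goodP _ Bb; exists X | exists set0].
have tagC b c v : b \in B -> c \in C b -> v \in c -> (v.1 \in b) && (v.2 < w v.1).
  move=> Bb Cc cv; have [[CA _ _ _] _] := Cgood _ Bb.
  by have := subsetP (CA _ Cc) _ cv; rewrite inE.
exists V, (fun v => g v.1), (fib (mem A)), (\bigcup_(b in B) C b); split.
- split.
  + move=> c /bigcupP[b Bb Cc]; apply/subsetP=> v cv; rewrite inE /=.
    by have /andP[bv ->] := tagC _ _ _ Bb Cc cv; rewrite (subsetP (BA _ Bb)).
  + move=> c /bigcupP[b Bb Cc] u v cu cv e; have [[_ Ck _ _] _] := Cgood _ Bb.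
    apply: (Ck _ Cc) => //; apply: (Bg _ Bb) e.
      by have /andP[] := tagC _ _ _ Bb Cc cu.
    by have /andP[] := tagC _ _ _ Bb Cc cv.
  + move=> u v; rewrite !inE /= => /andP[Au uw] /andP[Av vw] ne.
    have [b Bb /andP[bu bv]] := Bcov _ _ Au Av ne.
    have [[_ _ Ccov _] _] := Cgood _ Bb.
    have [|||c Cc cuv] := Ccov u v; rewrite ?inE /= ?bu ?bv //.
      by apply: contraNneq ne => ->.
    by exists c => //; apply/bigcupP; exists b.
  + move=> c c' /bigcupP[b Bb Cc] /bigcupP[b' Bb' Cc'] u v ne cu cv cu' cv'.
    have /andP[bu _] := tagC _ _ _ Bb Cc cu; have /andP[bv _] := tagC _ _ _ Bb Cc cv.
    have /andP[bu' _] := tagC _ _ _ Bb' Cc' cu'; have /andP[bv' _] := tagC _ _ _ Bb' Cc' cv'.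
    have [[_ Ck _ Cu] _] := Cgood _ Bb.
    (* Two points of an ingredient block lie over distinct base points, which determine the base
       block; uniqueness then reduces to a single ingredient. *)
    have ne1 : u.1 != v.1 by apply: contraNneq ne => e; apply/eqP/(Ck _ Cc).
    have ebb : b = b' by apply: (Buniq _ _ Bb Bb' u.1 v.1).
    by subst b'; apply: (Cu _ _ Cc Cc' u v).
- by move=> c /bigcupP[b Bb Cc]; have [_] := Cgood _ Bb; apply.
- move=> i; rewrite -hs -card_fib; apply: eq_card => v; rewrite !inE /=.
  by rewrite andbAC.
Qed.

(** * Transversal designs *)

(** New labels receive empty groups. This turns a design with few groups into an ingredient, whose
    type is indexed by all points of the master design. *)
Lemma has_4gdd_relabel (I J : finType) (h : I -> J) (s : I -> nat) (s' : J -> nat) :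
  injective h -> has_4gdd s -> (forall i, s' (h i) = s i) ->
  (forall j, j \notin codom h -> s' j = 0) -> has_4gdd s'.
Proof.
move=> h_inj [V [k [A [C [[CA Ck Ccov Cuniq] C4 hs]]]]] s'h s'0.
exists V, (h \o k), A, C; split=> //.
  split=> //.
    by move=> c Cc x y cx cy /h_inj; apply: (Ck _ Cc).
  by move=> x y Ax Ay; rewrite /= (inj_eq h_inj); apply: Ccov.
move=> j; case: (boolP (j \in codom h)) => [/codomP[i ->]|jh].
  by rewrite s'h -hs; apply: eq_card => x; rewrite !inE /= (inj_eq h_inj).
rewrite s'0 //; apply: eq_card0 => x; rewrite !inE /=; apply/negP => /andP[_ /eqP e].
by rewrite -e codom_f in jh.
Qed.

(* A transversal design TD(k, n) given as an orthogonal array: the block with index r : R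
   meets the i-th group in the point f i r. *)
Definition has_td (k n : nat) :=
  exists (F R : finType) (f : 'I_k -> R -> F),
    #|F| = n /\ forall i j, i != j -> bijective (fun r => (f i r, f j r)).

Definition td_block (k : nat) (F R : finType) (f : 'I_k -> R -> F) (r : R) : {set 'I_k * F} :=
  [set (i, f i r) | i : 'I_k].

Lemma in_td_block k (F R : finType) (f : 'I_k -> R -> F) r (v : 'I_k * F) :
  (v \in td_block f r) = (v.2 == f v.1 r).
Proof.
apply/imsetP/eqP => [[i _ ->] //|e]; exists v.1 => //.
by rewrite -e -surjective_pairing.
Qed.

Lemma td_is_gdd k (F R : finType) (f : 'I_k -> R -> F) :
  (forall i j, i != j -> bijective (fun r => (f i r, f j r))) ->
  is_gdd fst [set: 'I_k * F] [set td_block f r | r : R].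
Proof.
move=> f_bij; split.
- by move=> c _; apply/subsetP=> v; rewrite inE.
- move=> _ /imsetP[r _ ->] [i x] [j y]; rewrite !in_td_block /= => /eqP-> /eqP-> /= ->.
  by [].
- move=> [i x] [j y] _ _ /= ne; have [g gK Kg] := f_bij _ _ ne.
  have [ex ey] : f i (g (x, y)) = x /\ f j (g (x, y)) = y.
    by have := Kg (x, y) => -[].
  exists (td_block f (g (x, y))); first exact: imset_f.
  by rewrite !in_td_block /= ex ey !eqxx.
- move=> _ _ /imsetP[r _ ->] /imsetP[r' _ ->] [i x] [j y] ne.
  rewrite !in_td_block /= => /eqP ex /eqP ey /eqP ex' /eqP ey'.
  have neij : i != j by apply: contraNneq ne => eij; rewrite ex ey eij.
  by congr td_block; apply: (bij_inj (f_bij _ _ neij)); rewrite /= -ex -ey -ex' -ey'.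
Qed.

Lemma td_has_4gdd n : has_td 4 n -> has_4gdd (fun _ : 'I_4 => n).
Proof.
move=> [F [R [f [hF f_bij]]]].
exists ('I_4 * F)%type, fst, setT, [set td_block f r | r : R]; split.
- exact: td_is_gdd.
- move=> _ /imsetP[r _ ->]; rewrite card_imset ?card_ord //.
  by move=> i j /(congr1 fst).
move=> i; transitivity #|[set (i, x) | x : F]|; last first.
  by rewrite card_imset // => x y /(congr1 snd).
apply: eq_card => v; rewrite !inE /=; apply/eqP/imsetP => [<-|[x _ ->]] //.
by exists v.2 => //; rewrite -surjective_pairing.
Qed.

(** Every point gets weight [n], and a TD(4, n) is the ingredient over each block, whose four points
    [h] enumerates. *)
Lemma has_4gdd_inflate (I : finType) (s : I -> nat) n :
  has_td 4 n -> has_4gdd s -> has_4gdd (fun i => s i * n).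
Proof.
move=> tdn [V [k [A [C [hC C4 hs]]]]].
apply: (has_4gdd_weight (w := fun _ => n) hC) => [c Cc|i]; last first.
  rewrite sum_nat_const -hs; congr (_ * n); apply: eq_card => x; rewrite !inE.
  by [].
have c4 : size (enum c) = 4 by rewrite -cardE C4.
have [x0 _] : exists x, x \in c by apply/set0Pn; rewrite -card_gt0 C4.
pose h (i : 'I_4) := nth x0 (enum c) i.
have h_inj : injective h.
  by move=> i j /eqP; rewrite nth_uniq ?c4 ?enum_uniq // => /eqP/val_inj.
apply: (has_4gdd_relabel h_inj (td_has_4gdd tdn)) => [i|x].
  by rewrite -mem_enum mem_nth ?c4 // mul1n.
apply: contraNeq; rewrite muln_eq0 negb_or eqb0 negbK => /andP[xc _].
have lt4 : index x (enum c) < 4 by rewrite -c4 index_mem mem_enum.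
by apply/codomP; exists (Ordinal lt4); rewrite /h nth_index // mem_enum.
Qed.

(** Here the transversal design is the master design. Weights depend on the group and on the rank of
    a point in it; a block picks one point per group, that is, a choice function [e]. *)
Lemma has_4gdd_td k n (w : 'I_k -> 'I_n -> nat) :
  has_td k n -> (forall e : 'I_k -> 'I_n, has_4gdd (fun i => w i (e i))) ->
  has_4gdd (fun i => \sum_j w i j).
Proof.
move=> [F [R [f [hF f_bij]]]] ingr.
pose rk (x : F) : 'I_n := cast_ord hF (enum_rank x).
apply: (has_4gdd_weight (w := fun v : 'I_k * F => w v.1 (rk v.2)) (td_is_gdd f_bij)).
  move=> _ /imsetP[r _ ->].
  have h_inj : injective (fun i => (i, f i r)) by move=> i j [].
  apply: (has_4gdd_relabel h_inj (ingr (fun i => rk (f i r)))) => [i|v].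
    by rewrite in_td_block eqxx mul1n.
  rewrite in_td_block; case: eqP => // e /negP[]; apply/codomP; exists v.1.
  by rewrite -e -surjective_pairing.
move=> i.
rewrite (eq_bigl (fun v : 'I_k * F => (v.1 == i) && true)); last first.
  by move=> v; rewrite !inE andbT.
rewrite -(pair_big (pred1 i) predT (fun i x => w i (rk x))) /= big_pred1_eq.
have rk_bij : bijective rk.
  by apply: bij_comp (enum_rank_bij F); exists (cast_ord (esym hF)); [exact: cast_ordK | exact: cast_ordKV].
by rewrite [RHS](reindex rk) //; apply: onW_bij.
Qed.

Import GRing.Theory.

(** Parallel classes of the affine plane: column 0 is the first coordinate (infinite slope), and
    column [i > 0] has as slope the element of rank [i - 1] in [F]. Two finite slopes separate rows
    since [F] has no zero divisors. *)
Lemma has_td_field (F : finFieldType) k : k <= #|F|.+1 -> has_td k #|F|.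
Proof.
move=> lekF; pose m (i : 'I_k) : F := nth 0%R (enum F) i.-1.
have m_inj (i j : 'I_k) : 0 < i -> 0 < j -> i != j -> m i != m j.
  have lt_size (l : 'I_k) : 0 < l -> l.-1 < size (enum F).
    by move=> l0; rewrite -cardE -ltnS prednK //; apply: leq_trans (ltn_ord l) lekF.
  move=> i0 j0; apply: contraNneq => /eqP.
  rewrite nth_uniq ?enum_uniq ?lt_size // => /eqP e.
  by apply/eqP/val_inj; rewrite /= -(prednK i0) e prednK.
pose f (i : 'I_k) (r : F * F) : F := if i == 0 :> nat then r.1 else (r.2 + m i * r.1)%R.
exists F, (F * F)%type, f; split=> // i j ne.
suff f_inj : injective (fun r : F * F => (f i r, f j r)) by apply: inj_card_bij f_inj _.
move=> [r s] [r' s'].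
have cancel_s (t : F) : r = r' -> (s + t * r = s' + t * r')%R -> (r, s) = (r', s').
  by move=> -> /addIr->.
rewrite /f /=; case: (eqVneq (i : nat) 0) => [i0|i0]; case: (eqVneq (j : nat) 0) => [j0|j0].
- by case/eqP: ne; apply: val_inj; rewrite /= i0 j0.
- by move=> [er]; apply: cancel_s.
- by move=> [e er]; apply: cancel_s er e.
rewrite -!lt0n in i0 j0; move=> [ei ej]; apply: (cancel_s _ _ ei).
have : ((m i - m j) * (r - r') = 0)%R.
  have -> : ((m i - m j) * (r - r') = (s + m i * r) - (s' + m i * r') - ((s + m j * r) - (s' + m j * r')))%R.
    by rewrite mulrBl !mulrBr; ring.
  by rewrite ei ej !subrr.
move/eqP; rewrite mulf_eq0 !subr_eq0 (negPf (m_inj _ _ i0 j0 ne)) /=.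
by move/eqP.
Qed.

Lemma has_td_prime_power k p e : prime p -> 0 < e -> k <= (p ^ e).+1 -> has_td k (p ^ e).
Proof.
by move=> pp e0; have [F _ <-] := PrimePowerField pp e0; apply: has_td_field.
Qed.

(** * Cyclic difference families *)

Lemma uniq_map_inj_in (T T' : eqType) (f : T -> T') (s : seq T) :
  uniq (map f s) -> {in s &, injective f}.
Proof.
elim: s => //= a s IH /andP[na us] x y; rewrite !inE => /predU1P[->|xs] /predU1P[->|ys] // e.
- by rewrite e map_f in na.
- by rewrite -e map_f in na.
- exact: IH.
Qed.

Lemma uniq_flatten_map_inj (T T' : eqType) (f : T -> seq T') (s : seq T) x y z :
  uniq (flatten (map f s)) -> x \in s -> y \in s -> z \in f x -> z \in f y -> x = y.
Proof.
elim: s => //= a s IH; rewrite cat_uniq => /and3P[_ /hasPn disj us].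
have notin b : b \in s -> z \in f b -> z \in f a -> False.
  move=> bs zb za; have /disj/negP[] : z \in flatten (map f s); last exact: za.
    by apply/flattenP; exists (f b); rewrite ?map_f.
rewrite !inE => /predU1P[->|xs] /predU1P[->|ys] // zx zy.
- by case: (notin y).
- by case: (notin x).
- exact: IH.
Qed.

(** Reducing [y + t] modulo [n] changes the left side by a multiple of [n], hence of [l]. *)
Lemma modn_diff_translate l n x y t : l %| n -> y < n ->
  ((x + t) %% l + (n - (y + t) %% n)) %% l = (x + (n - y)) %% l.
Proof.
case/dvdnP=> m -> yn; have n0 : 0 < m * l by lia.
rewrite modnDml; have := divn_eq (y + t) (m * l); have := ltn_pmod (y + t) n0.
set k := (y + t) %/ _; set s := (y + t) %% _ => sn e.
have -> : x + t + (m * l - s) = k * m * l + (x + (m * l - y)) by nia.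
by rewrite modnMDl.
Qed.

(** The translation that moves [y] to [u] in the cycle of length [n] also moves [x] to [w] in the
    cycle of length [l], because the differences agree modulo [l]. *)
Lemma modn_translate l n x y u w : l %| n -> y < n -> u < n -> w < l ->
  (x + (n - y)) %% l = (w + (n - u)) %% l -> (x + (u + (n - y)) %% n) %% l = w.
Proof.
case/dvdnP=> m -> yn un wl e.
rewrite -modnDmr modn_dvdm ?dvdn_mull // modnDmr addnCA addnC -addnA.
have -> : x + (m * l - y + u) = x + (m * l - y) + u by lia.
by rewrite -modnDml e modnDml -addnA subnK ?(ltnW un) // addnC modnMDl modn_small.
Qed.

(* Points are pairs (i, u) with u an element of the i-th cycle, of length dividing n and
   contained in one group; the cyclic group Z_n rotates all cycles. For i < j, the orbit
   of the pair {(i, u), (j, v)} is determined by (i, j, v - u), because the i-th cycle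
   has length n as soon as the two cycles lie in different groups. *)
Section DifferenceFamily.

Variables (n : nat) (cycles : seq (nat * nat)).

Definition cycle_length i := (nth (0, 0) cycles i).1.
Definition cycle_group i := (nth (0, 0) cycles i).2.

(** [n - p.2] serves as the negative of [p.2], since the length of the second cycle divides [n]. *)
Definition pair_code (p q : nat * nat) :=
  (p.1, q.1, (q.2 + (n - p.2)) %% cycle_length q.1).

Definition block_codes (B : seq (nat * nat)) :=
  [seq pair_code pq.1 pq.2 | pq <- [seq (p, q) | p <- B, q <- B] & pq.1.1 < pq.2.1].

Definition split_cycles :=
  [seq ij <- [seq (i, j) | i <- iota 0 (size cycles), j <- iota 0 (size cycles)]
     | (ij.1 < ij.2) && (cycle_group ij.1 != cycle_group ij.2)].

Definition all_codes :=
  [seq (ij.1, ij.2, d) | ij <- split_cycles, d <- iota 0 (cycle_length ij.2)].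

Definition base_block (B : seq (nat * nat)) :=
  [&& size B == 4, all (fun p => (p.1 < size cycles) && (p.2 < cycle_length p.1)) B &
      uniq [seq cycle_group p.1 | p <- B]].

(** The last two clauses make each code of [all_codes] occur exactly once. The clause on
    [split_cycles] forces every cycle after a short one into the group of that short one, so short
    cycles stay within one group. *)
Definition difference_family (D : seq (seq (nat * nat))) :=
  [&& 0 < n, all (fun c => [&& 0 < c.1, c.1 %| n & c.2 < 6]) cycles,
      all (fun ij => cycle_length ij.1 == n) split_cycles,
      all base_block D, uniq (flatten (map block_codes D)) &
      all (fun c => c \in flatten (map block_codes D)) all_codes].

Variable D : seq (seq (nat * nat)).
Hypothesis DF : difference_family D.

Let V := ('I_(size cycles) * 'I_n)%type.
Let grp (v : V) : 'I_6 := inord (cycle_group v.1).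
Let A : {set V} := [set v : V | (v.2 : 'I_n) < cycle_length (v.1 : 'I__)].
Let translate (B : seq (nat * nat)) (t : nat) : {set V} :=
  
  [set v : V | ((v.1 : nat), (v.2 : nat)) \in [seq (p.1, (p.2 + t) %% cycle_length p.1) | p <- B]].

Let n_gt0 : 0 < n. Proof. by case/and5P: DF. Qed.

Let cyclesP i : i < size cycles ->
  [/\ 0 < cycle_length i, cycle_length i %| n & cycle_group i < 6].
Proof.
by case/and3P: DF => _ /(all_nthP (0, 0)) h _ /h /and3P.
Qed.

Let split_full i j : i < j -> j < size cycles -> cycle_group i != cycle_group j ->
  cycle_length i = n.
Proof.
move=> ij jc ne; case/and4P: DF => _ _ /allP h _; apply/eqP/(h (i, j)).
rewrite mem_filter /= ij ne /=; apply/allpairsP; exists (i, j).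
by rewrite !mem_iota; split=> //=; lia.
Qed.

Let grp_eq (v w : V) : (grp v == grp w) = (cycle_group v.1 == cycle_group w.1).
Proof.
have [_ _ hv] := cyclesP (ltn_ord v.1); have [_ _ hw] := cyclesP (ltn_ord w.1).
by rewrite -val_eqE /= !inordK.
Qed.

Let baseP B : B \in D -> base_block B.
Proof. by case/and5P: DF => _ _ _ /allP h _ /h. Qed.

Let base_inj B : B \in D -> {in B &, injective (fun p => cycle_group p.1)}.
Proof. by move=> /baseP/and3P[_ _ /uniq_map_inj_in]. Qed.

Let base_bound B p : B \in D -> p \in B -> p.1 < size cycles /\ p.2 < cycle_length p.1.
Proof. by move=> /baseP/and3P[_ /allP h _] /h/andP. Qed.

Let translateP (B : seq (nat * nat)) t v : v \in translate B t ->
  exists2 p, p \in B & v.1 = p.1 :> nat /\ v.2 = (p.2 + t) %% cycle_length p.1 :> nat.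
Proof. by rewrite inE => /mapP[p Bp [e1 e2]]; exists p. Qed.

Let translate_grp_inj B t : B \in D -> {in translate B t &, injective grp}.
Proof.
move=> DB v w /translateP[p Bp [p1 p2]] /translateP[q Bq [q1 q2]] /eqP.
rewrite grp_eq p1 q1 => /eqP/(base_inj DB Bp Bq) epq; subst q.
by rewrite (surjective_pairing v) (surjective_pairing w); congr pair; apply: val_inj;
  rewrite /= ?p1 ?q1 ?p2 ?q2.
Qed.

Let mem_codes B p q : p \in B -> q \in B -> p.1 < q.1 -> pair_code p q \in block_codes B.
Proof.
move=> Bp Bq lt; apply/mapP; exists (p, q) => //.
by rewrite mem_filter lt; apply/allpairsP; exists (p, q).
Qed.

(** The code of a pair of base points can be read off any translate: it is an invariant of the
    orbit. *)
Let code_translate B t (v w : V) p q : B \in D -> p \in B -> q \in B ->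
  v.1 = p.1 :> nat -> v.2 = (p.2 + t) %% cycle_length p.1 :> nat ->
  w.1 = q.1 :> nat -> w.2 = (q.2 + t) %% cycle_length q.1 :> nat ->
  cycle_length p.1 = n ->
  pair_code p q = (v.1 : nat, w.1 : nat, (w.2 + (n - v.2)) %% cycle_length w.1).
Proof.
move=> DB Bp Bq v1 v2 w1 w2 fulln.
rewrite /pair_code v1 w1 w2 v2; congr (_, _, _).
have [qc _] := base_bound DB Bq; have [_ dvd _] := cyclesP qc.
have [_ pn] := base_bound DB Bp; rewrite fulln in pn *.
by rewrite modn_diff_translate.
Qed.

(** The blocks are all [n] translates of the base blocks. The code of a pair of points singles out a
    base block, and the position of the first point then fixes the translation. *)
Lemma difference_family_gdd (s : 'I_6 -> nat) :
  (forall i : 'I_6, sumn [seq c.1 | c <- cycles & c.2 == i :> nat] = s i) -> has_4gdd s.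
Proof.
move=> hs.
have D_uniq : uniq (flatten (map block_codes D)) by case/and5P: DF => _ _ _ _ /andP[].
have D_all i j d : i < j -> j < size cycles -> cycle_group i != cycle_group j ->
    d < cycle_length j -> exists B p q, [/\ B \in D, p \in B, q \in B & pair_code p q = (i, j, d)].
  move=> ij jc ne dl; case/and5P: DF => _ _ _ _ /andP[_ /allP h].
  have /h : (i, j, d) \in all_codes.
    apply/allpairsPdep; exists (i, j), d; rewrite mem_iota; split=> //.
    rewrite mem_filter /= ij ne; apply/allpairsP; exists (i, j).
    by rewrite !mem_iota; split=> //=; lia.
  move=> /flattenP[_ /mapP[B DB ->] /mapP[[p q]]].
  rewrite mem_filter => /andP[_ /allpairsP[[p' q'] [Bp Bq e]]] ->.
  by case: e => -> ->; exists B, p', q'.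
have ltV (v : V) : v.2 < n by [].
pose C := [set translate (ssval B) t | B : seq_sub D, t : 'I_n].
have inC B (t : 'I_n) : B \in D -> translate B t \in C.
  by move=> DB; apply/imset2P; exists (SeqSub DB) t.
have CP c : c \in C -> exists2 B, B \in D & exists t : 'I_n, c = translate B t.
  by move=> /imset2P[[B DB] t _ _ ->]; exists B => //; exists t.
exists V, grp, A, C; split; first split.
- move=> _ /CP[B DB [t ->]]; apply/subsetP=> v /translateP[p Bp [e1 e2]].
  rewrite inE e1 e2 ltn_mod; have [pc _] := base_bound DB Bp.
  by have [] := cyclesP pc.
- by move=> _ /CP[B DB [t ->]]; apply: translate_grp_inj.
- move=> v w; rewrite !inE => Av Aw.
  wlog vw : v w Av Aw / v.1 < w.1.
    move=> IH ne; have [lt|gt|e] := ltngtP v.1 w.1; first exact: IH.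
      by have [|c Cc h] := IH w v Aw Av gt; [rewrite eq_sym | exists c; rewrite // andbC].
    by case/negP: ne; rewrite grp_eq e.
  rewrite grp_eq => ne.
  have full := split_full vw (ltn_ord _) ne.
  have [w0 wdvd _] := cyclesP (ltn_ord w.1).
  have [B [p [q [DB Bp Bq]]]] := D_all _ _ ((w.2 + (n - v.2)) %% cycle_length w.1) vw (ltn_ord _) ne (ltn_pmod _ w0).
  case=> p1 q1; rewrite q1 => e.
  have [_ pn] := base_bound DB Bp; rewrite p1 full in pn.
  (* This translation carries [p] to [v]; equality of the codes makes it carry [q] to [w]. *)
  pose t : 'I_n := Ordinal (ltn_pmod (v.2 + (n - p.2)) n_gt0).
  exists (translate B t); first exact: inC.
  apply/andP; split; rewrite inE; apply/mapP.
    exists p => //; rewrite p1 full /=; congr pair.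
    by rewrite modnDmr addnCA subnKC ?(ltnW pn) // modnDr modn_small.
  exists q => //; rewrite q1; congr pair.
  by rewrite (modn_translate wdvd pn (ltV v) Aw e).
- move=> _ _ /CP[B DB [t ->]] /CP[B' DB' [t' ->]] v w.
  wlog vw : v w / v.1 < w.1.
    move=> IH ne; have [lt|gt|e] := ltngtP v.1 w.1; first exact: IH.
      by move=> *; apply: (IH w v) => //; rewrite eq_sym.
    move=> Bv Bw; case/eqP: ne; apply: (translate_grp_inj DB Bv Bw).
    by apply/eqP; rewrite grp_eq e.
  move=> ne Bv Bw; have := Bw; have := Bv.
  move=> /translateP[p Bp [p1 p2]] /translateP[q Bq [q1 q2]].
  move=> /translateP[p' Bp' [p1' p2']] /translateP[q' Bq' [q1' q2']].
  have neg : cycle_group v.1 != cycle_group w.1.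
    rewrite -grp_eq; apply: contraNneq ne => e.
    by apply/eqP/(translate_grp_inj DB Bv Bw).
  have full := split_full vw (ltn_ord _) neg.
  have fp : cycle_length p.1 = n by rewrite -p1.
  have fp' : cycle_length p'.1 = n by rewrite -p1'.
  have c1 := code_translate DB Bp Bq p1 p2 q1 q2 fp.
  have c2 := code_translate DB' Bp' Bq' p1' p2' q1' q2' fp'.
  (* Both pairs of base points have the code of [(v, w)], and a code occurs in only one base
     block. *)
  have eB : B = B'.
    apply: (uniq_flatten_map_inj D_uniq DB DB' (z := pair_code p q)).
      by apply: mem_codes; rewrite -?p1 -?q1.
    by rewrite c1 -c2; apply: mem_codes; rewrite -?p1' -?q1'.
  subst B'; congr translate.
  (* Now [t] and [t'] carry the same base point to [v]; its cycle has full length [n], so they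
     agree. *)
  have ep : p = p' by apply: (base_inj DB Bp Bp'); rewrite -p1 -p1'.
  subst p'; move: p2'; rewrite p2 fp => /eqP; rewrite eqn_modDl !modn_small ?ltn_ord //.
  by move/eqP.
- move=> _ /CP[B DB [t ->]].
  have /and3P[/eqP B4 _ uB] := baseP DB.
  rewrite -B4 cardE -(size_map (fun v : V => (v.1 : nat, v.2 : nat))).
  rewrite -(size_map (fun p => (p.1, (p.2 + t) %% cycle_length p.1)) B).
  apply/perm_size/uniq_perm.
  + rewrite map_inj_uniq ?enum_uniq // => -[v1 v2] [w1 w2] /= [e1 e2].
    by congr pair; apply: val_inj.
  + rewrite map_inj_in_uniq => [|p q Bp Bq [e _]]; first exact: (map_uniq uB).
    by apply: (base_inj DB Bp Bq); rewrite e.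
  move=> x; apply/mapP/mapP => [[v]|[p Bp ->]].
    by rewrite mem_enum inE => /mapP[p Bp e] ->; exists p.
  have [pc _] := base_bound DB Bp; have [l0 ln _] := cyclesP pc.
  have lt_n : (p.2 + t) %% cycle_length p.1 < n.
    by apply: leq_trans (dvdn_leq n_gt0 ln); rewrite ltn_mod.
  exists (Ordinal pc, Ordinal lt_n) => //.
  by rewrite mem_enum inE /=; apply/mapP; exists p.
move=> i; rewrite -hs.
transitivity #|[set v : V | (grp (v.1, v.2) == i) && (v.2 < cycle_length v.1)]|.
  by apply: eq_card => v; rewrite !inE andbC -surjective_pairing.
rewrite (eq_card (B := [set v : V | (cycle_group v.1 == i) && (v.2 < cycle_length v.1)])).
  rewrite (@card_under_graph _ n (fun j : 'I_(size cycles) => cycle_group j == i) (fun j => cycle_length j)).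
    by rewrite sumnE big_map big_filter (big_nth (0, 0)) big_mkord.
  by move=> j; have [_ h _] := cyclesP (ltn_ord j); apply: dvdn_leq n_gt0 h.
move=> v; rewrite !inE -surjective_pairing -val_eqE /= inordK //.
by have [] := cyclesP (ltn_ord v.1).
Qed.

End DifferenceFamily.

(** * Small designs *)

Definition sizes (a b : nat) (i : 'I_6) : nat :=
  nth 0 [:: 3 * a; 3 * a; 3 * a; 3 * a; 6 * a; 3 * b] i.

(** With [n = 1] every cycle is a single point, and the family is a plain list of the 30 blocks. *)
Lemma gdd_1_1 : has_4gdd (sizes 1 1).
Proof.
apply: (@difference_family_gdd 1
  [:: (1,0); (1,0); (1,0); (1,1); (1,1); (1,1); (1,2); (1,2); (1,2); (1,3); (1,3); (1,3); (1,4); (1,4); (1,4); (1,4); (1,4); (1,4); (1,5); (1,5); (1,5)]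
  [:: [:: (0,0); (3,0); (17,0); (20,0)]; [:: (0,0); (4,0); (10,0); (15,0)];
      [:: (0,0); (5,0); (7,0); (14,0)]; [:: (0,0); (6,0); (16,0); (19,0)];
      [:: (0,0); (8,0); (11,0); (13,0)]; [:: (0,0); (9,0); (12,0); (18,0)];
      [:: (1,0); (3,0); (8,0); (12,0)]; [:: (1,0); (4,0); (14,0); (19,0)];
      [:: (1,0); (5,0); (11,0); (15,0)]; [:: (1,0); (6,0); (9,0); (17,0)];
      [:: (1,0); (7,0); (13,0); (18,0)]; [:: (1,0); (10,0); (16,0); (20,0)];
      [:: (2,0); (3,0); (9,0); (14,0)]; [:: (2,0); (4,0); (6,0); (13,0)];
      [:: (2,0); (5,0); (16,0); (18,0)]; [:: (2,0); (7,0); (10,0); (17,0)];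
      [:: (2,0); (8,0); (15,0); (20,0)]; [:: (2,0); (11,0); (12,0); (19,0)];
      [:: (3,0); (6,0); (15,0); (18,0)]; [:: (3,0); (7,0); (11,0); (16,0)];
      [:: (3,0); (10,0); (13,0); (19,0)]; [:: (4,0); (7,0); (12,0); (20,0)];
      [:: (4,0); (8,0); (9,0); (16,0)]; [:: (4,0); (11,0); (17,0); (18,0)];
      [:: (5,0); (6,0); (10,0); (12,0)]; [:: (5,0); (8,0); (17,0); (19,0)];
      [:: (5,0); (9,0); (13,0); (20,0)]; [:: (6,0); (11,0); (14,0); (20,0)];
      [:: (7,0); (9,0); (15,0); (19,0)]; [:: (8,0); (10,0); (14,0); (18,0)]]);
  first by vm_compute.
by move=> [[|[|[|[|[|[|i]]]]]] hi].
Qed.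

(** Here and in the larger cases [n = 3a]: a group of size [3a] is one full cycle, the group of size
    [6a] is two, and the last group is cut into cycles of lengths dividing [n]. There are
    [14n + 18b] codes, six per base block, hence [7a + 3b] base blocks however the last group is
    cut. *)
Lemma gdd_1_2 : has_4gdd (sizes 1 2).
Proof.
apply: (@difference_family_gdd 3
  [:: (3,0); (3,1); (3,2); (3,3); (3,4); (3,4); (1,5); (1,5); (1,5); (1,5); (1,5); (1,5)]
  [:: [:: (0,0); (1,0); (2,0); (3,0)]; [:: (0,0); (1,1); (4,0); (9,0)];
      [:: (0,0); (1,2); (5,1); (7,0)]; [:: (0,0); (2,1); (4,2); (6,0)];
      [:: (0,0); (2,2); (5,2); (11,0)]; [:: (0,0); (3,1); (5,0); (8,0)];
      [:: (0,0); (3,2); (4,1); (10,0)]; [:: (1,0); (2,1); (4,1); (8,0)];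
      [:: (1,0); (2,2); (5,0); (10,0)]; [:: (1,0); (3,1); (5,1); (6,0)];
      [:: (1,0); (3,2); (4,0); (11,0)]; [:: (2,0); (3,1); (5,2); (9,0)];
      [:: (2,0); (3,2); (4,2); (7,0)]]);
  first by vm_compute.
by move=> [[|[|[|[|[|[|i]]]]]] hi].
Qed.

Lemma gdd_2_2 : has_4gdd (sizes 2 2).
Proof.
apply: (@difference_family_gdd 6
  [:: (6,0); (6,1); (6,2); (6,3); (6,4); (6,4); (3,5); (2,5); (1,5)]
  [:: [:: (0,0); (1,0); (3,2); (5,3)]; [:: (0,0); (1,1); (2,3); (5,0)];
      [:: (0,0); (1,2); (4,5); (7,1)]; [:: (0,0); (1,3); (3,0); (5,5)];
      [:: (0,0); (1,4); (4,0); (6,0)]; [:: (0,0); (1,5); (2,5); (4,3)];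
      [:: (0,0); (2,0); (3,3); (4,2)]; [:: (0,0); (2,1); (3,5); (5,2)];
      [:: (0,0); (2,2); (5,4); (6,1)]; [:: (0,0); (2,4); (4,4); (8,0)];
      [:: (0,0); (3,1); (5,1); (7,0)]; [:: (0,0); (3,4); (4,1); (6,2)];
      [:: (1,0); (2,1); (3,0); (4,0)]; [:: (1,0); (2,3); (5,1); (6,0)];
      [:: (1,0); (2,4); (3,5); (4,1)]; [:: (1,0); (2,5); (5,4); (7,0)];
      [:: (1,0); (3,1); (4,5); (6,1)]; [:: (1,0); (3,4); (5,0); (8,0)];
      [:: (2,0); (3,0); (4,1); (7,0)]; [:: (2,0); (3,2); (5,0); (6,1)]]);
  first by vm_compute.
by move=> [[|[|[|[|[|[|i]]]]]] hi].
Qed.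

Lemma gdd_2_3 : has_4gdd (sizes 2 3).
Proof.
apply: (@difference_family_gdd 6
  [:: (6,0); (6,1); (6,2); (6,3); (6,4); (6,4); (2,5); (2,5); (2,5); (2,5); (1,5)]
  [:: [:: (0,0); (1,0); (5,1); (8,0)]; [:: (0,0); (1,1); (5,4); (7,1)];
      [:: (0,0); (1,2); (3,2); (5,0)]; [:: (0,0); (1,3); (2,3); (4,2)];
      [:: (0,0); (1,4); (4,5); (10,0)]; [:: (0,0); (1,5); (2,2); (3,1)];
      [:: (0,0); (2,0); (5,5); (9,0)]; [:: (0,0); (2,1); (4,3); (6,1)];
      [:: (0,0); (2,4); (3,5); (4,4)]; [:: (0,0); (2,5); (5,3); (6,0)];
      [:: (0,0); (3,0); (4,1); (8,1)]; [:: (0,0); (3,3); (5,2); (7,0)];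
      [:: (0,0); (3,4); (4,0); (9,1)]; [:: (1,0); (2,1); (4,2); (7,1)];
      [:: (1,0); (2,2); (4,0); (8,1)]; [:: (1,0); (2,4); (3,4); (5,5)];
      [:: (1,0); (2,5); (5,2); (9,0)]; [:: (1,0); (3,1); (4,4); (6,1)];
      [:: (1,0); (3,3); (5,0); (6,0)]; [:: (1,0); (3,5); (4,3); (9,1)];
      [:: (2,0); (3,2); (5,2); (8,0)]; [:: (2,0); (3,3); (4,3); (7,1)];
      [:: (2,0); (3,4); (5,0); (10,0)]]);
  first by vm_compute.
by move=> [[|[|[|[|[|[|i]]]]]] hi].
Qed.

Lemma gdd_2_4 : has_4gdd (sizes 2 4).
Proof.
apply: (@difference_family_gdd 6
  [:: (6,0); (6,1); (6,2); (6,3); (6,4); (6,4); (3,5); (2,5); (2,5); (2,5); (1,5); (1,5); (1,5)]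
  [:: [:: (0,0); (1,0); (2,5); (3,0)]; [:: (0,0); (1,1); (5,4); (6,2)];
      [:: (0,0); (1,2); (5,2); (10,0)]; [:: (0,0); (1,3); (2,0); (3,4)];
      [:: (0,0); (1,4); (4,2); (8,1)]; [:: (0,0); (1,5); (4,5); (6,1)];
      [:: (0,0); (2,1); (4,0); (9,1)]; [:: (0,0); (2,2); (5,0); (8,0)];
      [:: (0,0); (2,3); (4,1); (12,0)]; [:: (0,0); (2,4); (5,1); (7,1)];
      [:: (0,0); (3,1); (5,5); (11,0)]; [:: (0,0); (3,2); (4,3); (6,0)];
      [:: (0,0); (3,3); (5,3); (7,0)]; [:: (0,0); (3,5); (4,4); (9,0)];
      [:: (1,0); (2,0); (5,1); (6,0)]; [:: (1,0); (2,1); (4,1); (11,0)];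
      [:: (1,0); (2,2); (5,2); (9,1)]; [:: (1,0); (2,4); (4,5); (7,0)];
      [:: (1,0); (3,2); (5,4); (9,0)]; [:: (1,0); (3,3); (4,3); (7,1)];
      [:: (1,0); (3,4); (5,5); (12,0)]; [:: (1,0); (3,5); (4,2); (8,0)];
      [:: (2,0); (3,0); (4,2); (10,0)]; [:: (2,0); (3,2); (5,5); (6,2)];
      [:: (2,0); (3,3); (5,2); (8,1)]; [:: (2,0); (3,5); (4,3); (6,1)]]);
  first by vm_compute.
by move=> [[|[|[|[|[|[|i]]]]]] hi].
Qed.

Lemma gdd_3_4 : has_4gdd (sizes 3 4).
Proof.
apply: (@difference_family_gdd 9
  [:: (9,0); (9,1); (9,2); (9,3); (9,4); (9,4); (3,5); (3,5); (3,5); (1,5); (1,5); (1,5)]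
  [:: [:: (0,0); (1,0); (2,6); (3,6)]; [:: (0,0); (1,1); (5,6); (7,0)];
      [:: (0,0); (1,2); (4,4); (8,2)]; [:: (0,0); (1,3); (2,4); (5,0)];
      [:: (0,0); (1,4); (3,0); (4,8)]; [:: (0,0); (1,5); (2,5); (5,4)];
      [:: (0,0); (1,6); (3,1); (4,6)]; [:: (0,0); (1,7); (5,2); (8,0)];
      [:: (0,0); (1,8); (4,5); (7,2)]; [:: (0,0); (2,0); (4,3); (9,0)];
      [:: (0,0); (2,1); (4,2); (10,0)]; [:: (0,0); (2,2); (3,8); (5,5)];
      [:: (0,0); (2,3); (4,7); (6,0)]; [:: (0,0); (2,7); (3,3); (5,8)];
      [:: (0,0); (2,8); (5,1); (6,1)]; [:: (0,0); (3,2); (4,0); (11,0)];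
      [:: (0,0); (3,4); (4,1); (6,2)]; [:: (0,0); (3,5); (5,3); (7,1)];
      [:: (0,0); (3,7); (5,7); (8,1)]; [:: (1,0); (2,2); (5,0); (11,0)];
      [:: (1,0); (2,3); (3,7); (4,8)]; [:: (1,0); (2,4); (5,1); (6,2)];
      [:: (1,0); (2,5); (4,3); (7,1)]; [:: (1,0); (2,7); (4,7); (8,1)];
      [:: (1,0); (2,8); (3,2); (4,5)]; [:: (1,0); (3,0); (5,3); (9,0)];
      [:: (1,0); (3,1); (5,2); (10,0)]; [:: (1,0); (3,3); (5,7); (6,0)];
      [:: (1,0); (3,8); (4,1); (6,1)]; [:: (2,0); (3,1); (5,0); (8,2)];
      [:: (2,0); (3,2); (5,4); (7,0)]; [:: (2,0); (3,7); (4,2); (7,1)];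
      [:: (2,0); (3,8); (4,8); (8,1)]]);
  first by vm_compute.
by move=> [[|[|[|[|[|[|i]]]]]] hi].
Qed.

Lemma gdd_3_5 : has_4gdd (sizes 3 5).
Proof.
apply: (@difference_family_gdd 9
  [:: (9,0); (9,1); (9,2); (9,3); (9,4); (9,4); (9,5); (1,5); (1,5); (1,5); (1,5); (1,5); (1,5)]
  [:: [:: (0,0); (1,0); (3,3); (4,7)]; [:: (0,0); (1,1); (2,3); (4,3)];
      [:: (0,0); (1,2); (5,0); (6,8)]; [:: (0,0); (1,3); (2,8); (3,8)];
      [:: (0,0); (1,4); (5,5); (6,5)]; [:: (0,0); (1,5); (5,7); (11,0)];
      [:: (0,0); (1,6); (5,1); (6,4)]; [:: (0,0); (1,7); (2,6); (3,0)];
      [:: (0,0); (1,8); (4,2); (8,0)]; [:: (0,0); (2,0); (4,4); (6,6)];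
      [:: (0,0); (2,1); (4,0); (6,0)]; [:: (0,0); (2,2); (3,4); (5,8)];
      [:: (0,0); (2,4); (4,5); (10,0)]; [:: (0,0); (2,5); (5,4); (6,1)];
      [:: (0,0); (2,7); (5,3); (6,7)]; [:: (0,0); (3,1); (4,8); (6,3)];
      [:: (0,0); (3,2); (5,2); (7,0)]; [:: (0,0); (3,5); (4,1); (6,2)];
      [:: (0,0); (3,6); (4,6); (12,0)]; [:: (0,0); (3,7); (5,6); (9,0)];
      [:: (1,0); (2,0); (4,6); (6,3)]; [:: (1,0); (2,1); (5,5); (12,0)];
      [:: (1,0); (2,3); (3,1); (5,3)]; [:: (1,0); (2,4); (4,0); (7,0)];
      [:: (1,0); (2,6); (4,4); (9,0)]; [:: (1,0); (2,7); (5,8); (6,0)];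
      [:: (1,0); (3,0); (5,6); (10,0)]; [:: (1,0); (3,4); (5,0); (6,5)];
      [:: (1,0); (3,6); (4,5); (6,4)]; [:: (1,0); (3,7); (4,8); (6,2)];
      [:: (1,0); (3,8); (4,1); (6,8)]; [:: (2,0); (3,1); (5,2); (6,4)];
      [:: (2,0); (3,4); (5,7); (8,0)]; [:: (2,0); (3,5); (5,3); (6,1)];
      [:: (2,0); (3,6); (4,3); (11,0)]; [:: (2,0); (3,8); (4,2); (6,7)]]);
  first by vm_compute.
by move=> [[|[|[|[|[|[|i]]]]]] hi].
Qed.

Lemma gdd_4_5 : has_4gdd (sizes 4 5).
Proof.
apply: (@difference_family_gdd 12
  [:: (12,0); (12,1); (12,2); (12,3); (12,4); (12,4); (12,5); (2,5); (1,5)]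
  [:: [:: (0,0); (1,0); (2,10); (4,8)]; [:: (0,0); (1,1); (2,5); (3,9)];
      [:: (0,0); (1,2); (3,7); (5,2)]; [:: (0,0); (1,3); (3,6); (5,8)];
      [:: (0,0); (1,4); (5,1); (6,3)]; [:: (0,0); (1,5); (4,4); (6,2)];
      [:: (0,0); (1,6); (5,5); (8,0)]; [:: (0,0); (1,7); (2,1); (4,10)];
      [:: (0,0); (1,8); (3,3); (5,6)]; [:: (0,0); (1,9); (2,11); (4,6)];
      [:: (0,0); (1,10); (5,0); (6,1)]; [:: (0,0); (1,11); (5,7); (6,0)];
      [:: (0,0); (2,0); (4,11); (6,8)]; [:: (0,0); (2,2); (3,2); (5,3)];
      [:: (0,0); (2,3); (3,1); (4,5)]; [:: (0,0); (2,4); (5,10); (6,4)];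
      [:: (0,0); (2,6); (5,11); (6,7)]; [:: (0,0); (2,7); (4,1); (7,0)];
      [:: (0,0); (2,8); (4,9); (6,10)]; [:: (0,0); (2,9); (3,8); (5,4)];
      [:: (0,0); (3,0); (5,9); (7,1)]; [:: (0,0); (3,4); (4,3); (6,11)];
      [:: (0,0); (3,5); (4,2); (6,5)]; [:: (0,0); (3,10); (4,0); (6,6)];
      [:: (0,0); (3,11); (4,7); (6,9)]; [:: (1,0); (2,0); (3,6); (4,4)];
      [:: (1,0); (2,1); (4,6); (6,5)]; [:: (1,0); (2,3); (5,1); (6,8)];
      [:: (1,0); (2,5); (4,1); (7,1)]; [:: (1,0); (2,7); (3,10); (4,10)];
      [:: (1,0); (2,8); (5,4); (6,7)]; [:: (1,0); (2,9); (5,6); (6,4)];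
      [:: (1,0); (2,11); (3,4); (5,3)]; [:: (1,0); (3,0); (4,7); (6,2)];
      [:: (1,0); (3,1); (4,2); (6,6)]; [:: (1,0); (3,2); (5,7); (7,0)];
      [:: (1,0); (3,9); (4,0); (6,0)]; [:: (1,0); (3,11); (4,5); (6,10)];
      [:: (2,0); (3,1); (5,11); (6,10)]; [:: (2,0); (3,2); (5,2); (6,6)];
      [:: (2,0); (3,7); (4,0); (8,0)]; [:: (2,0); (3,8); (5,0); (6,9)];
      [:: (2,0); (3,9); (5,3); (6,3)]]);
  first by vm_compute.
by move=> [[|[|[|[|[|[|i]]]]]] hi].
Qed.

Lemma gdd_4_6 : has_4gdd (sizes 4 6).
Proof.
apply: (@difference_family_gdd 12
  [:: (12,0); (12,1); (12,2); (12,3); (12,4); (12,4); (3,5); (3,5); (3,5); (3,5); (2,5); (2,5); (1,5); (1,5)]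
  [:: [:: (0,0); (1,0); (2,8); (3,8)]; [:: (0,0); (1,1); (4,4); (10,0)];
      [:: (0,0); (1,2); (2,6); (4,3)]; [:: (0,0); (1,3); (5,5); (11,0)];
      [:: (0,0); (1,4); (2,11); (4,0)]; [:: (0,0); (1,5); (4,7); (9,1)];
      [:: (0,0); (1,6); (2,0); (3,6)]; [:: (0,0); (1,7); (5,2); (8,2)];
      [:: (0,0); (1,8); (3,7); (5,8)]; [:: (0,0); (1,9); (4,2); (10,1)];
      [:: (0,0); (1,10); (3,4); (5,1)]; [:: (0,0); (1,11); (5,3); (11,1)];
      [:: (0,0); (2,1); (3,3); (5,11)]; [:: (0,0); (2,2); (5,9); (8,1)];
      [:: (0,0); (2,3); (4,10); (6,0)]; [:: (0,0); (2,4); (4,6); (9,2)];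
      [:: (0,0); (2,5); (5,7); (7,2)]; [:: (0,0); (2,7); (5,4); (9,0)];
      [:: (0,0); (2,9); (4,8); (8,0)]; [:: (0,0); (2,10); (3,1); (5,6)];
      [:: (0,0); (3,0); (4,5); (12,0)]; [:: (0,0); (3,2); (4,1); (6,1)];
      [:: (0,0); (3,5); (4,9); (7,0)]; [:: (0,0); (3,9); (5,0); (13,0)];
      [:: (0,0); (3,10); (5,10); (6,2)]; [:: (0,0); (3,11); (4,11); (7,1)];
      [:: (1,0); (2,0); (5,5); (12,0)]; [:: (1,0); (2,1); (3,10); (4,6)];
      [:: (1,0); (2,2); (5,1); (7,1)]; [:: (1,0); (2,3); (3,1); (4,11)];
      [:: (1,0); (2,5); (5,9); (6,0)]; [:: (1,0); (2,9); (4,0); (13,0)];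
      [:: (1,0); (2,10); (4,10); (7,2)]; [:: (1,0); (2,11); (5,11); (6,1)];
      [:: (1,0); (3,2); (4,9); (9,1)]; [:: (1,0); (3,3); (5,10); (7,0)];
      [:: (1,0); (3,4); (5,6); (8,2)]; [:: (1,0); (3,5); (4,7); (6,2)];
      [:: (1,0); (3,7); (4,4); (8,0)]; [:: (1,0); (3,9); (5,8); (9,0)];
      [:: (2,0); (3,1); (4,4); (11,1)]; [:: (2,0); (3,4); (4,10); (8,1)];
      [:: (2,0); (3,5); (4,6); (11,0)]; [:: (2,0); (3,7); (5,1); (10,1)];
      [:: (2,0); (3,8); (5,6); (9,0)]; [:: (2,0); (3,11); (5,3); (10,0)]]);
  first by vm_compute.
by move=> [[|[|[|[|[|[|i]]]]]] hi].
Qed.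

Lemma gdd_4_7 : has_4gdd (sizes 4 7).
Proof.
apply: (@difference_family_gdd 12
  [:: (12,0); (12,1); (12,2); (12,3); (12,4); (12,4); (12,5); (1,5); (1,5); (1,5); (1,5); (1,5); (1,5); (1,5); (1,5); (1,5)]
  [:: [:: (0,0); (1,0); (4,2); (6,7)]; [:: (0,0); (1,1); (2,1); (3,4)];
      [:: (0,0); (1,2); (2,7); (3,6)]; [:: (0,0); (1,3); (5,6); (6,6)];
      [:: (0,0); (1,4); (4,3); (15,0)]; [:: (0,0); (1,5); (2,4); (4,1)];
      [:: (0,0); (1,6); (3,2); (4,7)]; [:: (0,0); (1,7); (2,5); (3,5)];
      [:: (0,0); (1,8); (5,2); (12,0)]; [:: (0,0); (1,9); (5,4); (7,0)];
      [:: (0,0); (1,10); (5,11); (6,9)]; [:: (0,0); (1,11); (4,11); (6,8)];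
      [:: (0,0); (2,0); (4,5); (6,5)]; [:: (0,0); (2,2); (5,9); (6,11)];
      [:: (0,0); (2,3); (4,10); (8,0)]; [:: (0,0); (2,6); (5,8); (6,0)];
      [:: (0,0); (2,8); (4,4); (6,10)]; [:: (0,0); (2,9); (5,1); (6,4)];
      [:: (0,0); (2,10); (3,11); (5,7)]; [:: (0,0); (2,11); (5,10); (6,3)];
      [:: (0,0); (3,0); (4,6); (6,2)]; [:: (0,0); (3,1); (4,0); (9,0)];
      [:: (0,0); (3,3); (5,3); (13,0)]; [:: (0,0); (3,7); (5,0); (11,0)];
      [:: (0,0); (3,8); (5,5); (10,0)]; [:: (0,0); (3,9); (4,9); (6,1)];
      [:: (0,0); (3,10); (4,8); (14,0)]; [:: (1,0); (2,1); (4,5); (11,0)];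
      [:: (1,0); (2,2); (4,3); (10,0)]; [:: (1,0); (2,3); (5,4); (6,1)];
      [:: (1,0); (2,4); (3,2); (5,9)]; [:: (1,0); (2,6); (4,6); (13,0)];
      [:: (1,0); (2,7); (4,9); (6,8)]; [:: (1,0); (2,8); (5,8); (9,0)];
      [:: (1,0); (2,9); (5,0); (14,0)]; [:: (1,0); (3,0); (5,2); (8,0)];
      [:: (1,0); (3,1); (4,4); (6,2)]; [:: (1,0); (3,5); (5,11); (6,0)];
      [:: (1,0); (3,6); (5,10); (6,6)]; [:: (1,0); (3,7); (5,5); (6,4)];
      [:: (1,0); (3,9); (4,10); (6,5)]; [:: (1,0); (3,11); (4,7); (6,10)];
      [:: (2,0); (3,2); (4,6); (6,8)]; [:: (2,0); (3,4); (4,11); (12,0)];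
      [:: (2,0); (3,5); (5,8); (6,3)]; [:: (2,0); (3,6); (4,3); (7,0)];
      [:: (2,0); (3,7); (5,6); (6,0)]; [:: (2,0); (3,8); (4,10); (6,11)];
      [:: (2,0); (3,9); (5,10); (15,0)]]);
  first by vm_compute.
by move=> [[|[|[|[|[|[|i]]]]]] hi].
Qed.

Lemma gdd_6_7 : has_4gdd (sizes 6 7).
Proof.
apply: (@difference_family_gdd 18
  [:: (18,0); (18,1); (18,2); (18,3); (18,4); (18,4); (9,5); (1,5); (1,5); (1,5); (1,5); (1,5); (1,5); (1,5); (1,5); (1,5); (1,5); (1,5); (1,5)]
  [:: [:: (0,0); (1,0); (3,12); (4,7)]; [:: (0,0); (1,1); (2,10); (4,17)];
      [:: (0,0); (1,2); (2,2); (5,9)]; [:: (0,0); (1,3); (2,9); (4,4)];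
      [:: (0,0); (1,4); (3,14); (5,16)]; [:: (0,0); (1,5); (5,1); (6,2)];
      [:: (0,0); (1,6); (4,14); (12,0)]; [:: (0,0); (1,7); (3,7); (5,10)];
      [:: (0,0); (1,8); (5,17); (6,7)]; [:: (0,0); (1,9); (5,4); (9,0)];
      [:: (0,0); (1,10); (2,15); (5,11)]; [:: (0,0); (1,11); (3,10); (5,15)];
      [:: (0,0); (1,12); (5,2); (6,5)]; [:: (0,0); (1,13); (3,2); (5,12)];
      [:: (0,0); (1,14); (2,8); (4,13)]; [:: (0,0); (1,15); (4,0); (11,0)];
      [:: (0,0); (1,16); (2,12); (3,13)]; [:: (0,0); (1,17); (4,10); (13,0)];
      [:: (0,0); (2,0); (5,0); (16,0)]; [:: (0,0); (2,1); (3,4); (4,11)];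
      [:: (0,0); (2,3); (5,8); (6,6)]; [:: (0,0); (2,4); (3,15); (5,14)];
      [:: (0,0); (2,5); (4,9); (14,0)]; [:: (0,0); (2,6); (4,6); (6,1)];
      [:: (0,0); (2,7); (4,5); (6,4)]; [:: (0,0); (2,11); (3,5); (4,8)];
      [:: (0,0); (2,13); (3,17); (4,3)]; [:: (0,0); (2,14); (3,11); (4,2)];
      [:: (0,0); (2,16); (4,12); (6,0)]; [:: (0,0); (2,17); (5,3); (6,8)];
      [:: (0,0); (3,0); (4,15); (17,0)]; [:: (0,0); (3,1); (5,5); (8,0)];
      [:: (0,0); (3,3); (4,1); (10,0)]; [:: (0,0); (3,6); (5,13); (15,0)];
      [:: (0,0); (3,8); (4,16); (7,0)]; [:: (0,0); (3,9); (5,6); (6,3)];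
      [:: (0,0); (3,16); (5,7); (18,0)]; [:: (1,0); (2,1); (3,6); (4,0)];
      [:: (1,0); (2,2); (3,9); (5,10)]; [:: (1,0); (2,3); (5,5); (7,0)];
      [:: (1,0); (2,4); (3,3); (5,15)]; [:: (1,0); (2,7); (4,9); (15,0)];
      [:: (1,0); (2,8); (3,4); (5,2)]; [:: (1,0); (2,10); (5,16); (17,0)];
      [:: (1,0); (2,11); (4,2); (18,0)]; [:: (1,0); (2,13); (4,6); (8,0)];
      [:: (1,0); (2,15); (5,6); (10,0)]; [:: (1,0); (2,16); (3,8); (4,10)];
      [:: (1,0); (2,17); (5,0); (6,4)]; [:: (1,0); (3,1); (4,15); (6,0)];
      [:: (1,0); (3,2); (4,12); (6,3)]; [:: (1,0); (3,5); (4,5); (6,7)];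
      [:: (1,0); (3,11); (5,11); (14,0)]; [:: (1,0); (3,13); (4,14); (6,1)];
      [:: (1,0); (3,14); (4,13); (16,0)]; [:: (1,0); (3,16); (4,4); (6,5)];
      [:: (2,0); (3,0); (5,13); (12,0)]; [:: (2,0); (3,2); (5,16); (6,7)];
      [:: (2,0); (3,6); (5,17); (6,1)]; [:: (2,0); (3,8); (4,1); (6,8)];
      [:: (2,0); (3,9); (5,15); (11,0)]; [:: (2,0); (3,13); (5,3); (13,0)];
      [:: (2,0); (3,16); (4,3); (9,0)]]);
  first by vm_compute.
by move=> [[|[|[|[|[|[|i]]]]]] hi].
Qed.

Lemma gdd_6_8 : has_4gdd (sizes 6 8).
Proof.
apply: (@difference_family_gdd 18
  [:: (18,0); (18,1); (18,2); (18,3); (18,4); (18,4); (3,5); (3,5); (2,5); (2,5); (6,5); (6,5); (2,5)]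
  [:: [:: (0,0); (1,0); (2,12); (3,12)]; [:: (0,0); (1,1); (5,15); (11,5)];
      [:: (0,0); (1,2); (3,1); (5,9)]; [:: (0,0); (1,3); (4,9); (12,1)];
      [:: (0,0); (1,4); (3,15); (4,3)]; [:: (0,0); (1,5); (3,5); (4,0)];
      [:: (0,0); (1,6); (4,10); (6,0)]; [:: (0,0); (1,7); (3,3); (5,12)];
      [:: (0,0); (1,8); (5,7); (10,3)]; [:: (0,0); (1,9); (2,4); (3,13)];
      [:: (0,0); (1,10); (4,17); (10,1)]; [:: (0,0); (1,11); (2,14); (4,5)];
      [:: (0,0); (1,12); (5,4); (7,0)]; [:: (0,0); (1,13); (2,0); (5,13)];
      [:: (0,0); (1,14); (2,11); (5,17)]; [:: (0,0); (1,15); (5,6); (12,0)];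
      [:: (0,0); (1,16); (2,17); (4,7)]; [:: (0,0); (1,17); (4,14); (11,4)];
      [:: (0,0); (2,1); (4,2); (10,2)]; [:: (0,0); (2,2); (3,17); (4,15)];
      [:: (0,0); (2,3); (3,2); (5,0)]; [:: (0,0); (2,5); (3,11); (4,12)];
      [:: (0,0); (2,6); (4,8); (11,2)]; [:: (0,0); (2,7); (4,6); (7,1)];
      [:: (0,0); (2,8); (3,6); (5,16)]; [:: (0,0); (2,9); (5,2); (6,2)];
      [:: (0,0); (2,10); (5,1); (10,0)]; [:: (0,0); (2,13); (4,1); (10,4)];
      [:: (0,0); (2,15); (5,14); (11,1)]; [:: (0,0); (2,16); (5,5); (11,3)];
      [:: (0,0); (3,0); (4,4); (10,5)]; [:: (0,0); (3,4); (4,16); (9,0)];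
      [:: (0,0); (3,7); (5,11); (7,2)]; [:: (0,0); (3,8); (4,13); (8,1)];
      [:: (0,0); (3,9); (4,11); (11,0)]; [:: (0,0); (3,10); (5,10); (9,1)];
      [:: (0,0); (3,14); (5,8); (6,1)]; [:: (0,0); (3,16); (5,3); (8,0)];
      [:: (1,0); (2,0); (5,4); (10,5)]; [:: (1,0); (2,2); (3,3); (4,0)];
      [:: (1,0); (2,4); (5,16); (8,0)]; [:: (1,0); (2,6); (3,8); (4,16)];
      [:: (1,0); (2,7); (4,11); (6,2)]; [:: (1,0); (2,8); (5,13); (9,1)];
      [:: (1,0); (2,9); (5,11); (11,0)]; [:: (1,0); (2,10); (4,10); (8,1)];
      [:: (1,0); (2,11); (3,5); (5,12)]; [:: (1,0); (2,14); (4,8); (7,1)];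
      [:: (1,0); (2,16); (4,3); (9,0)]; [:: (1,0); (2,17); (3,2); (5,15)];
      [:: (1,0); (3,1); (5,2); (10,2)]; [:: (1,0); (3,6); (5,8); (11,2)];
      [:: (1,0); (3,7); (5,6); (6,1)]; [:: (1,0); (3,9); (4,2); (7,2)];
      [:: (1,0); (3,10); (4,1); (10,0)]; [:: (1,0); (3,13); (5,1); (10,4)];
      [:: (1,0); (3,15); (4,14); (11,1)]; [:: (1,0); (3,16); (4,5); (11,3)];
      [:: (2,0); (3,4); (5,0); (10,4)]; [:: (2,0); (3,5); (4,15); (11,0)];
      [:: (2,0); (3,7); (4,3); (12,0)]; [:: (2,0); (3,8); (4,11); (6,0)];
      [:: (2,0); (3,10); (5,3); (7,1)]; [:: (2,0); (3,11); (5,14); (12,1)];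
      [:: (2,0); (3,13); (5,10); (11,1)]; [:: (2,0); (3,14); (4,14); (10,0)]]);
  first by vm_compute.
by move=> [[|[|[|[|[|[|i]]]]]] hi].
Qed.

Lemma gdd_6_10 : has_4gdd (sizes 6 10).
Proof.
apply: (@difference_family_gdd 18
  [:: (18,0); (18,1); (18,2); (18,3); (18,4); (18,4); (9,5); (9,5); (2,5); (2,5); (2,5); (2,5); (2,5); (2,5)]
  [:: [:: (0,0); (1,0); (2,7); (3,7)]; [:: (0,0); (1,1); (4,5); (6,6)];
      [:: (0,0); (1,2); (2,0); (3,6)]; [:: (0,0); (1,3); (5,13); (6,3)];
      [:: (0,0); (1,4); (3,15); (4,15)]; [:: (0,0); (1,5); (4,3); (13,1)];
      [:: (0,0); (1,6); (4,14); (6,7)]; [:: (0,0); (1,7); (4,16); (12,1)];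
      [:: (0,0); (1,8); (3,3); (5,12)]; [:: (0,0); (1,9); (2,10); (3,1)];
      [:: (0,0); (1,10); (2,13); (4,4)]; [:: (0,0); (1,11); (5,9); (13,0)];
      [:: (0,0); (1,12); (5,8); (7,1)]; [:: (0,0); (1,13); (5,16); (12,0)];
      [:: (0,0); (1,14); (2,11); (5,11)]; [:: (0,0); (1,15); (4,10); (7,0)];
      [:: (0,0); (1,16); (2,4); (3,16)]; [:: (0,0); (1,17); (5,4); (7,5)];
      [:: (0,0); (2,1); (5,0); (7,3)]; [:: (0,0); (2,2); (5,17); (7,6)];
      [:: (0,0); (2,3); (5,5); (6,2)]; [:: (0,0); (2,5); (4,11); (7,4)];
      [:: (0,0); (2,6); (5,10); (10,1)]; [:: (0,0); (2,8); (5,6); (6,0)];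
      [:: (0,0); (2,9); (3,12); (5,14)]; [:: (0,0); (2,12); (3,2); (4,13)];
      [:: (0,0); (2,14); (4,9); (9,0)]; [:: (0,0); (2,15); (4,2); (8,0)];
      [:: (0,0); (2,16); (4,1); (6,1)]; [:: (0,0); (2,17); (4,17); (11,1)];
      [:: (0,0); (3,0); (4,8); (8,1)]; [:: (0,0); (3,4); (5,2); (7,8)];
      [:: (0,0); (3,5); (5,1); (6,5)]; [:: (0,0); (3,8); (5,7); (11,0)];
      [:: (0,0); (3,9); (4,12); (10,0)]; [:: (0,0); (3,10); (5,3); (6,8)];
      [:: (0,0); (3,11); (5,15); (7,2)]; [:: (0,0); (3,13); (4,7); (9,1)];
      [:: (0,0); (3,14); (4,6); (7,7)]; [:: (0,0); (3,17); (4,0); (6,4)];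
      [:: (1,0); (2,0); (5,8); (9,1)]; [:: (1,0); (2,2); (3,12); (5,13)];
      [:: (1,0); (2,4); (4,2); (6,8)]; [:: (1,0); (2,5); (4,1); (7,5)];
      [:: (1,0); (2,8); (4,7); (10,0)]; [:: (1,0); (2,9); (5,12); (11,0)];
      [:: (1,0); (2,10); (4,3); (7,8)]; [:: (1,0); (2,11); (4,15); (6,2)];
      [:: (1,0); (2,12); (3,9); (4,14)]; [:: (1,0); (2,13); (5,7); (8,1)];
      [:: (1,0); (2,14); (5,6); (6,7)]; [:: (1,0); (2,17); (5,0); (7,4)];
      [:: (1,0); (3,1); (4,0); (6,3)]; [:: (1,0); (3,2); (4,17); (6,6)];
      [:: (1,0); (3,3); (4,5); (7,2)]; [:: (1,0); (3,5); (5,11); (6,4)];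
      [:: (1,0); (3,6); (4,10); (11,1)]; [:: (1,0); (3,8); (4,6); (7,0)];
      [:: (1,0); (3,14); (5,9); (8,0)]; [:: (1,0); (3,15); (5,2); (9,0)];
      [:: (1,0); (3,16); (5,1); (7,1)]; [:: (1,0); (3,17); (5,17); (10,1)];
      [:: (2,0); (3,1); (5,9); (6,7)]; [:: (2,0); (3,2); (4,15); (6,5)];
      [:: (2,0); (3,4); (4,10); (7,1)]; [:: (2,0); (3,5); (4,12); (13,1)];
      [:: (2,0); (3,7); (5,14); (13,0)]; [:: (2,0); (3,11); (4,7); (12,1)];
      [:: (2,0); (3,13); (5,7); (12,0)]; [:: (2,0); (3,14); (5,6); (6,6)];
      [:: (2,0); (3,16); (5,13); (7,3)]; [:: (2,0); (3,17); (4,8); (7,6)]]);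
  first by vm_compute.
by move=> [[|[|[|[|[|[|i]]]]]] hi].
Qed.

Lemma gdd_6_11 : has_4gdd (sizes 6 11).
Proof.
apply: (@difference_family_gdd 18
  [:: (18,0); (18,1); (18,2); (18,3); (18,4); (18,4); (18,5); (3,5); (3,5); (1,5); (1,5); (1,5); (1,5); (1,5); (1,5); (1,5); (1,5); (1,5)]
  [:: [:: (0,0); (1,0); (2,6); (3,10)]; [:: (0,0); (1,1); (5,4); (6,2)];
      [:: (0,0); (1,2); (5,0); (6,14)]; [:: (0,0); (1,3); (5,7); (7,2)];
      [:: (0,0); (1,4); (5,12); (9,0)]; [:: (0,0); (1,5); (2,9); (3,6)];
      [:: (0,0); (1,6); (4,2); (6,6)]; [:: (0,0); (1,7); (4,6); (6,16)];
      [:: (0,0); (1,8); (2,13); (3,13)]; [:: (0,0); (1,9); (4,0); (12,0)];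
      [:: (0,0); (1,10); (3,16); (5,2)]; [:: (0,0); (1,11); (2,10); (3,1)];
      [:: (0,0); (1,12); (4,10); (7,1)]; [:: (0,0); (1,13); (2,15); (4,15)];
      [:: (0,0); (1,14); (5,5); (6,10)]; [:: (0,0); (1,15); (4,7); (8,2)];
      [:: (0,0); (1,16); (2,1); (3,15)]; [:: (0,0); (1,17); (4,3); (16,0)];
      [:: (0,0); (2,0); (5,11); (10,0)]; [:: (0,0); (2,2); (5,6); (6,13)];
      [:: (0,0); (2,3); (4,13); (6,15)]; [:: (0,0); (2,4); (4,1); (6,4)];
      [:: (0,0); (2,5); (5,15); (13,0)]; [:: (0,0); (2,7); (5,9); (11,0)];
      [:: (0,0); (2,8); (4,11); (8,1)]; [:: (0,0); (2,11); (4,5); (14,0)];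
      [:: (0,0); (2,12); (4,8); (6,7)]; [:: (0,0); (2,14); (4,9); (6,17)];
      [:: (0,0); (2,16); (5,1); (15,0)]; [:: (0,0); (2,17); (3,12); (5,8)];
      [:: (0,0); (3,0); (5,17); (6,9)]; [:: (0,0); (3,2); (5,3); (7,0)];
      [:: (0,0); (3,3); (4,17); (6,8)]; [:: (0,0); (3,4); (4,12); (6,1)];
      [:: (0,0); (3,5); (5,10); (6,11)]; [:: (0,0); (3,7); (5,14); (17,0)];
      [:: (0,0); (3,8); (5,16); (6,0)]; [:: (0,0); (3,9); (4,4); (6,5)];
      [:: (0,0); (3,11); (5,13); (8,0)]; [:: (0,0); (3,14); (4,14); (6,12)];
      [:: (0,0); (3,17); (4,16); (6,3)]; [:: (1,0); (2,0); (5,7); (6,2)];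
      [:: (1,0); (2,1); (5,15); (6,15)]; [:: (1,0); (2,7); (4,12); (6,6)];
      [:: (1,0); (2,8); (4,1); (6,16)]; [:: (1,0); (2,9); (4,13); (7,0)];
      [:: (1,0); (2,10); (5,11); (6,17)]; [:: (1,0); (2,11); (5,5); (8,0)];
      [:: (1,0); (2,12); (5,0); (6,4)]; [:: (1,0); (2,13); (3,2); (4,3)];
      [:: (1,0); (2,14); (4,15); (17,0)]; [:: (1,0); (2,15); (5,14); (6,13)];
      [:: (1,0); (2,16); (5,13); (6,7)]; [:: (1,0); (3,0); (5,6); (6,3)];
      [:: (1,0); (3,3); (4,5); (6,5)]; [:: (1,0); (3,4); (4,7); (15,0)];
      [:: (1,0); (3,7); (5,1); (8,1)]; [:: (1,0); (3,9); (5,2); (6,10)];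
      [:: (1,0); (3,11); (4,0); (6,11)]; [:: (1,0); (3,12); (5,12); (14,0)];
      [:: (1,0); (3,13); (4,11); (11,0)]; [:: (1,0); (3,14); (5,17); (6,8)];
      [:: (1,0); (3,15); (4,6); (13,0)]; [:: (1,0); (3,16); (4,8); (10,0)];
      [:: (2,0); (3,1); (4,6); (8,0)]; [:: (2,0); (3,2); (5,0); (12,0)];
      [:: (2,0); (3,3); (4,7); (7,2)]; [:: (2,0); (3,5); (4,16); (6,4)];
      [:: (2,0); (3,6); (5,16); (6,1)]; [:: (2,0); (3,8); (4,2); (6,15)];
      [:: (2,0); (3,10); (5,5); (7,1)]; [:: (2,0); (3,11); (4,17); (9,0)];
      [:: (2,0); (3,12); (4,9); (6,5)]; [:: (2,0); (3,16); (5,13); (6,6)];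
      [:: (2,0); (3,17); (5,8); (16,0)]]);
  first by vm_compute.
by move=> [[|[|[|[|[|[|i]]]]]] hi].
Qed.

(** * Recursion *)

(* Rows of a difference matrix over Z_6 x Z_2, found by computer; 6 * t + z stands for (z, t). *)
Definition difference_matrix12 : seq (seq nat) :=
  [:: nseq 12 0; iota 0 12;
      [:: 0; 7; 11; 5; 2; 6; 4; 10; 9; 8; 3; 1];
      [:: 0; 3; 9; 8; 5; 11; 10; 6; 4; 1; 7; 2];
      [:: 0; 8; 5; 7; 6; 3; 11; 9; 2; 10; 1; 4];
      [:: 0; 11; 8; 6; 1; 4; 7; 3; 10; 2; 5; 9]].

Definition add12 (x y : nat) := (x + y) %% 6 + 6 * odd (x %/ 6 + y %/ 6).

(** The array developed from the difference matrix: the difference of the entries in two columns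
    determines [x], and then either entry gives the shift [c]. *)
Definition oa12 (i x c : nat) := add12 (nth 0 (nth [::] difference_matrix12 i) x) c.

(** All 144 rows are compared by computation, so no group law for [add12] is needed. *)
Lemma oa12_uniq i j : i < 6 -> j < 6 -> i != j ->
  uniq [seq (oa12 i r.1 r.2, oa12 j r.1 r.2) | r <- [seq (x, c) | x <- iota 0 12, c <- iota 0 12]].
Proof.
have ok : all (fun i => all (fun j => (i != j) ==>
    uniq [seq (oa12 i r.1 r.2, oa12 j r.1 r.2) | r <- [seq (x, c) | x <- iota 0 12, c <- iota 0 12]])
    (iota 0 6)) (iota 0 6) by vm_compute.
move=> i6 j6; apply/implyP; move/allP: ok => /(_ i); rewrite mem_iota => /(_ i6)/allP/(_ j).
by rewrite mem_iota; apply.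
Qed.

Lemma has_td12 : has_td 6 12.
Proof.
have oa_lt i x c : oa12 i x c < 12.
  by rewrite /oa12 /add12; set y := nth _ _ _; have := ltn_pmod (y + c) (isT : 0 < 6); case: odd; lia.
pose f (i : 'I_6) (r : 'I_12 * 'I_12) := Ordinal (oa_lt i r.1 r.2).
exists 'I_12, ('I_12 * 'I_12)%type, f; split=> [|i j ne]; first exact: card_ord.
suff f_inj : injective (fun r => (f i r, f j r)) by apply: inj_card_bij f_inj _.
have /uniq_map_inj_in u := oa12_uniq (ltn_ord i) (ltn_ord j) ne.
have mem_pairs (z t : 'I_12) : (val z, val t) \in [seq (x, c) | x <- iota 0 12, c <- iota 0 12].
  by apply/allpairsP; exists (val z, val t); rewrite !mem_iota !ltn_ord.
move=> [x c] [y d] e.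
have e' : (oa12 i x c, oa12 j x c) = (oa12 i y d, oa12 j y d).
  exact: (congr1 (fun p : 'I_12 * 'I_12 => (val p.1, val p.2)) e).
have [ex ec] := u (val x, val c) (val y, val d) (mem_pairs _ _) (mem_pairs _ _) e'.
by congr pair; apply: val_inj.
Qed.

Lemma eq_has_4gdd (I : finType) (s s' : I -> nat) : s =1 s' -> has_4gdd s -> has_4gdd s'.
Proof.
by move=> e [V [k [A [C [hC C4 hs]]]]]; exists V, k, A, C; split=> // i; rewrite hs e.
Qed.

(** The whole range of [b] is kept together, because the recursion mixes ingredients with the same
    [c] and different last groups. *)
Definition feasible a := forall b, a <= b <= 2 * a -> has_4gdd (sizes a b).

(** Greedy filling of [n] places of capacity [c] with [d] units; truncated subtraction yields 0 once
    the units are used up. *)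
Lemma sum_minn c d n : \sum_(i < n) minn c (d - i * c) = minn (n * c) d.
Proof.
elim: n => [|n IH]; first by rewrite big_ord0 min0n.
by rewrite big_ord_recr /= IH; lia.
Qed.

(* The last weight varies with the point: b is a sum of n values e j in [c, 2 c]. *)
Lemma feasible_td c n : has_td 6 n -> feasible c -> feasible (c * n).
Proof.
move=> tdn fc b hb.
(* Every point gets [c], and the surplus [b - c * n], at most [n * c], is dealt out greedily. *)
pose e (j : nat) := c + minn c (b - c * n - j * c).
pose w (i : 'I_6) (j : 'I_n) := sizes c (e j) i.
have sum_e : \sum_(j < n) e j = b.
  by rewrite big_split /= sum_nat_const card_ord sum_minn; lia.
have : has_4gdd (fun i => \sum_j w i j).
  apply: has_4gdd_td tdn _ => g.
  (* Only the point chosen in the sixth group matters: the other five weights are constant. *)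
  have /fc : c <= e (g ord_max) <= 2 * c by rewrite /e; lia.
  by apply: eq_has_4gdd => -[[|[|[|[|[|[|i]]]]]] hi] //; rewrite /w /sizes /=; congr (3 * e (val (g _))); apply: val_inj.
apply: eq_has_4gdd => -[[|[|[|[|[|[|i]]]]]] hi] //; rewrite /w /sizes /=.
1-5: by rewrite sum_nat_const card_ord mulnC mulnA.
by rewrite -big_distrr /= sum_e.
Qed.

Lemma has_td4_3 : has_td 4 3. Proof. exact: (@has_td_prime_power 4 3 1). Qed.
Lemma has_td4_4 : has_td 4 4. Proof. exact: (@has_td_prime_power 4 2 2). Qed.

Lemma sizes_inflate a b n : has_td 4 n -> has_4gdd (sizes a b) -> has_4gdd (sizes (a * n) (b * n)).
Proof.
move=> tdn /(has_4gdd_inflate tdn); apply: eq_has_4gdd.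
by move=> [[|[|[|[|[|[|i]]]]]] hi] //; rewrite /sizes /= mulnA.
Qed.

Lemma feasible1 : feasible 1.
Proof. by move=> [|[|[|b]]] // _; [exact: gdd_1_1 | exact: gdd_1_2]. Qed.

Lemma feasible2 : feasible 2.
Proof. by move=> [|[|[|[|[|b]]]]] // _; [exact: gdd_2_2 | exact: gdd_2_3 | exact: gdd_2_4]. Qed.

Lemma feasible3 : feasible 3.
Proof.
move=> [|[|[|[|[|[|[|b]]]]]]] // _.
- exact: (sizes_inflate has_td4_3 gdd_1_1).
- exact: gdd_3_4.
- exact: gdd_3_5.
- exact: (sizes_inflate has_td4_3 gdd_1_2).
Qed.

Lemma feasible4 : feasible 4.
Proof.
move=> [|[|[|[|[|[|[|[|[|b]]]]]]]]] // _.
- exact: (sizes_inflate has_td4_4 gdd_1_1).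
- exact: gdd_4_5.
- exact: gdd_4_6.
- exact: gdd_4_7.
- exact: (sizes_inflate has_td4_4 gdd_1_2).
Qed.

Lemma feasible6 : feasible 6.
Proof.
move=> [|[|[|[|[|[|[|[|[|[|[|[|[|b]]]]]]]]]]]]] // _.
- exact: (sizes_inflate has_td4_3 gdd_2_2).
- exact: gdd_6_7.
- exact: gdd_6_8.
- exact: (sizes_inflate has_td4_3 gdd_2_3).
- exact: gdd_6_10.
- exact: gdd_6_11.
- exact: (sizes_inflate has_td4_3 gdd_2_4).
Qed.

(** The array of order 12 settles all thirteen values of [b] at once from the two designs for
    [a = 1]. *)
Lemma feasible12 : feasible 12.
Proof. by rewrite -[12]mul1n; apply: feasible_td has_td12 feasible1. Qed.

(** Neither [p] nor [e] exceeds [p ^ e], so both are below 5 and finitely many cases remain. *)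
Lemma prime_power_lt5_dvd12 p e : prime p -> 0 < e -> p ^ e < 5 -> p ^ e %| 12.
Proof.
move=> p_pr e0 lt5.
have lt_e : e < p ^ e by apply: ltn_expl (prime_gt1 p_pr).
have le_p : p ^ 1 <= p ^ e by exact: (leq_pexp2l (prime_gt0 p_pr) e0).
rewrite expn1 in le_p; have {lt_e le_p} [p4 e4] : p < 5 /\ e < 5 by lia.
move: lt5 p_pr e0; case: p p4 => [|[|[|[|[|p]]]]] //; case: e e4 => [|[|[|[|[|e]]]]] //.
Qed.

(* Split off the prime power factors that are at least 5; what is left divides 12. *)
Lemma feasible_all a : 0 < a -> feasible a.
Proof.
have [m] := ubnP a; elim: m a => // m IH a lt_am a0.
have [/allP small|] := boolP (all (fun p => p ^ logn p a < 5) (primes a)).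
  have : a %| 12.
    apply/dvdn_partP => // p pa; rewrite p_part.
    have := pa; rewrite mem_primes => /and3P[p_pr _ pdiv].
    by apply: prime_power_lt5_dvd12 (small _ pa); rewrite // logn_gt0.
  case: a a0 {lt_am small} => [|[|[|[|[|[|[|[|[|[|[|[|[|a]]]]]]]]]]]]] // _ dv.
  - exact: feasible1.
  - exact: feasible2.
  - exact: feasible3.
  - exact: feasible4.
  - exact: feasible6.
  - exact: feasible12.
case/allPn => p pa; rewrite -leqNgt => ge5.
have := pa; rewrite mem_primes => /and3P[p_pr _ pdiv].
have lg0 : 0 < logn p a by rewrite logn_gt0.
(* The full [p]-part is removed at once: for [p] equal to 2 or 3 a smaller power might fall below
   5. *)
have tdp : has_td 6 (p ^ logn p a) by apply: has_td_prime_power.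
have dv : p ^ logn p a %| a := pfactor_dvdnn p a.
rewrite -(divnK dv); apply: feasible_td tdp _.
apply: IH; last by rewrite divn_gt0 ?expn_gt0 ?prime_gt0 // dvdn_leq.
by rewrite (leq_trans _ (lt_am : a <= m)) // ltn_Pdiv //; lia.
Qed.

(** * Return from labelled designs to set partitions *)

Lemma exists_4GDD_of_sizes a b : 0 < a -> 0 < b -> has_4gdd (sizes a b) ->
  exists_4GDD [:: (3 * a, 4); (6 * a, 1); (3 * b, 1)].
Proof.
move=> a0 b0 hgdd.
set ty := [:: _; _; _]; rewrite /exists_4GDD.
(* Nonempty fibres are pairwise distinct sets, so the six labels give six parts of the partition,
   even where sizes coincide. *)
have sizes_gt0 i : 0 < sizes a b i.
  by case: i => -[|[|[|[|[|[|i]]]]]] hi //=; rewrite /sizes /=; lia.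
(* The labelling comes from enumerating the region under the graph of [sizes a b]; the design is
   then transported onto it. *)
have [k hk] : exists k : 'I_(gdd_type_points ty) -> 'I_6,
    forall i, #|[set x in setT | k x == i]| = sizes a b i.
  pose N := \max_i sizes a b i.
  have le_N i : sizes a b i <= N by apply: leq_bigmax.
  pose W := [set v : 'I_6 * 'I_N | predT v.1 && (v.2 < sizes a b v.1)].
  have cardW : #|W| = gdd_type_points ty.
    rewrite card_under_graph // !big_ord_recl big_ord0 /sizes /gdd_type_points /=; lia.
  pose e x := enum_val (cast_ord (esym cardW) x).
  exists (fun x => (e x).1) => i.
  rewrite -[RHS](big_pred1_eq addn i (sizes a b)) -(card_under_graph _ le_N).
  have e_inj : injective e by move=> x y /enum_val_inj/cast_ord_inj.
  rewrite -(card_imset _ e_inj); apply: eq_card => v; rewrite !inE.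
  apply/imsetP/andP => [[x]|[/= vi vW]].
    rewrite !inE /= => ex ->; split=> //.
    by have := enum_valP (cast_ord (esym cardW) x); rewrite inE.
  have Wv : v \in W by rewrite inE.
  exists (cast_ord cardW (enum_rank_in Wv v)).
    by rewrite !inE /e cast_ordK enum_rankK_in.
  by rewrite /e cast_ordK enum_rankK_in.
have [B [_ Bk Bcov Buniq] B4] := has_4gdd_on hgdd hk.
pose G := preim_partition k setT.
have partG : partition G setT := preim_partitionP k setT.
have [/eqP covG trivG G0] := and3P partG.
have pblockE x y : (pblock G x == pblock G y) = (k x == k y).
  rewrite eq_pblock ?covG ?inE // pblock_equivalence_partition ?inE //.
  by split=> // /eqP->.
have group_pt i : exists x, k x = i.
  have /card_gt0P[x] : 0 < #|[set x in setT | k x == i]| by rewrite hk.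
  by rewrite !inE => /eqP; exists x.
exists G, B; split.
  split.
  - by [].
  (* Any two points in different groups force a block to exist. *)
  - have [x kx] := group_pt ord0; have [y ky] := group_pt ord_max.
    have [|||c Bc _] := Bcov x y; rewrite ?inE ?kx ?ky //.
    by apply/set0Pn; exists c.
  - by move=> c /B4.
  - move=> c x y Bc cx cy; apply: contraNneq => /eqP; rewrite pblockE => /eqP e.
    by apply/eqP/(Bk _ Bc).
  - move=> x y; rewrite pblockE => ne; apply/eqP/cards1P.
    have [|||c Bc /andP[cx cy]] := Bcov x y; rewrite ?inE //.
    exists c; apply/setP=> d; rewrite !inE; apply/and3P/eqP => [[Bd dx dy]|->] //.
    by apply: (Buniq _ _ Bd Bc x y) => //; apply: contraNneq ne => ->.
pose fib i := [set x | k x == i].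
have fib_inj : injective fib.
  move=> i j e; have [x kx] := group_pt i; have : x \in fib j by rewrite -e inE kx.
  by rewrite inE kx => /eqP.
have GE : G = [set fib i | i : 'I_6].
  apply/setP=> c; apply/imsetP/imsetP => [[x _ ->]|[i _ ->]].
    by exists (k x) => //; apply/setP=> y; rewrite !inE eq_sym.
  have [x kx] := group_pt i; exists x; rewrite ?inE //.
  by apply/setP=> y; rewrite !inE kx eq_sym.
have /(perm_map (fun A : {set _} => #|A|)) : perm_eq (enum G) (map fib (enum 'I_6)).
  apply: uniq_perm; [exact: enum_uniq | by rewrite map_inj_uniq ?enum_uniq | move=> c].
  by rewrite mem_enum GE; apply/imsetP/mapP => -[i _ ->]; exists i; rewrite ?mem_enum.
move/perm_trans; apply.
rewrite -map_comp (eq_map (_ : _ =1 sizes a b)); last first.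
  by move=> i /=; rewrite -hk; apply: eq_card => x; rewrite !inE.
by rewrite !enum_ordSl enum_ord0.
Qed.

Theorem theorem3p2 (a b : nat) (ha : 0 < a) (hb : 0 < b) :
  exists_4GDD [:: (3 * a, 4); (6 * a, 1); (3 * b, 1)] <-> a <= b <= 2 * a.
Proof.
split; first exact: exists_4GDD_bounds.
by move=> /(feasible_all ha); apply: exists_4GDD_of_sizes.
Qed.
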